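(* Let $G$ be an infinite torsion-generated virtually cyclic group, and suppose $G=A\ast_C B$ with $A,B$ finite and $[A:C]=[B:C]=2$. Suppose that the image of the natural map $N_G(C)\to\mathrm{Aut}(C)$ (given by conjugation) is equal to $\mathrm{Inn}(C)$. Then $G$ is first-order rigid; in fact, every finitely generated group $\mathrm{AE}$-equivalent to $G$ is isomorphic to $G$.
   Context: A group is torsion-generated if it is generated by elements of finite order. A finitely generated group $G$ is first-order rigid if every finitely generated group elementarily equivalent to $G$ is isomorphic to $G$. Two groups are $\mathrm{AE}$-equivalent if they satisfy the same first-order sentences of the form $\forall\bar x\exists\bar y\,\theta(\bar x,\bar y)$ with $\theta$ quantifier-free. *)

(* Defs.v *)
From Stdlib Require Import List Arith.
Import ListNotations.

Record Grp : Type := {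
  carrier :> Type;
  gmul : carrier -> carrier -> carrier;
  gone : carrier;
  ginv : carrier -> carrier;
  gmul_assoc : forall x y z, gmul x (gmul y z) = gmul (gmul x y) z;
  gmul_1l : forall x, gmul gone x = x;
  gmul_1r : forall x, gmul x gone = x;
  gmul_Vl : forall x, gmul (ginv x) x = gone;
  gmul_Vr : forall x, gmul x (ginv x) = gone
}.

Arguments gmul {g}.
Arguments gone {g}.
Arguments ginv {g}.

Definition is_hom {G H : Grp} (f : G -> H) : Prop :=
  forall x y, f (gmul x y) = gmul (f x) (f y).

Definition isomorphic (G H : Grp) : Prop :=
  exists (f : G -> H) (g : H -> G),
    is_hom f /\ (forall x, g (f x) = x) /\ (forall y, f (g y) = y).

Fixpoint gpow {G : Grp} (g : G) (n : nat) : G :=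
  match n with O => gone | S k => gmul g (gpow g k) end.

Definition finite_order {G : Grp} (g : G) : Prop :=
  exists n, 0 < n /\ gpow g n = gone.

Fixpoint gprod {G : Grp} (l : list G) : G :=
  match l with [] => gone | x :: r => gmul x (gprod r) end.

Definition subgroup {G : Grp} (S : G -> Prop) : Prop :=
  S gone /\ (forall x y, S x -> S y -> S (gmul x y)) /\ (forall x, S x -> S (ginv x)).

Definition finite_set {G : Grp} (S : G -> Prop) : Prop :=
  exists l : list G, forall x, S x <-> In x l.

Definition infinite_group (G : Grp) : Prop := ~ finite_set (fun _ : G => True).

Definition has_index {G : Grp} (A K : G -> Prop) (n : nat) : Prop :=
  subgroup A /\ subgroup K /\ (forall x, K x -> A x) /\
  exists l : list G, length l = n /\
    (forall a, In a l -> A a) /\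
    (forall i j, i < n -> j < n ->
        K (gmul (ginv (nth i l gone)) (nth j l gone)) -> i = j) /\
    (forall x, A x -> exists i, i < n /\ K (gmul (ginv (nth i l gone)) x)).

Definition cyclic_subgroup {G : Grp} (K : G -> Prop) : Prop :=
  exists z : G, forall x, K x <-> exists n, x = gpow z n \/ x = ginv (gpow z n).

Definition virtually_cyclic (G : Grp) : Prop :=
  exists (K : G -> Prop) (n : nat),
    has_index (fun _ => True) K n /\ cyclic_subgroup K.

Definition finitely_generated (G : Grp) : Prop :=
  exists gens : list G, forall x : G, exists l : list G,
    (forall y, In y l -> In y gens \/ In (ginv y) gens) /\ x = gprod l.

Definition torsion_generated (G : Grp) : Prop :=
  forall x : G, exists l : list G, (forall y, In y l -> finite_order y) /\ x = gprod l.

(* Internal amalgamated free product decomposition G = A *_C B: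
   A, B subgroups of G with C = A ∩ B, and G together with the inclusions of
   A and B is the pushout of A <- C -> B (universal property). *)
Definition amalgam_decomp (G : Grp) (A B C : G -> Prop) : Prop :=
  subgroup A /\ subgroup B /\
  (forall x, C x <-> (A x /\ B x)) /\
  forall (H : Grp) (f g : G -> H),
    (forall x y, A x -> A y -> f (gmul x y) = gmul (f x) (f y)) ->
    (forall x y, B x -> B y -> g (gmul x y) = gmul (g x) (g y)) ->
    (forall x, C x -> f x = g x) ->
    (exists h : G -> H, is_hom h /\ (forall x, A x -> h x = f x) /\
                                     (forall x, B x -> h x = g x)) /\
    (forall h1 h2 : G -> H, is_hom h1 -> is_hom h2 ->
       (forall x, A x -> h1 x = f x) -> (forall x, B x -> h1 x = g x) ->
       (forall x, A x -> h2 x = f x) -> (forall x, B x -> h2 x = g x) ->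
       forall x, h1 x = h2 x).

Definition normalizes {G : Grp} (C : G -> Prop) (g : G) : Prop :=
  forall x, C x <-> C (gmul (gmul g x) (ginv g)).

(* the image of N_G(C) -> Aut(C) (conjugation) equals Inn(C).
   (Inn(C) is always contained in the image since C <= N_G(C).) *)
Definition normalizer_image_inner {G : Grp} (C : G -> Prop) : Prop :=
  forall g : G, normalizes C g ->
    exists c, C c /\ forall x, C x ->
      gmul (gmul g x) (ginv g) = gmul (gmul c x) (ginv c).

Inductive term : Type :=
| TVar : nat -> term
| TOne : term
| TMul : term -> term -> term
| TInv : term -> term.

Fixpoint teval {G : Grp} (e : nat -> G) (t : term) : G :=
  match t with
  | TVar n => e n
  | TOne => gone
  | TMul a b => gmul (teval e a) (teval e b)
  | TInv a => ginv (teval e a)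
  end.

Fixpoint tvars (t : term) : list nat :=
  match t with
  | TVar n => [n]
  | TOne => []
  | TMul a b => tvars a ++ tvars b
  | TInv a => tvars a
  end.

Inductive formula : Type :=
| FEq : term -> term -> formula
| FFalse : formula
| FNot : formula -> formula
| FAnd : formula -> formula -> formula
| FOr : formula -> formula -> formula
| FImp : formula -> formula -> formula
| FAll : nat -> formula -> formula
| FEx : nat -> formula -> formula.

Definition upd {G : Grp} (e : nat -> G) (n : nat) (v : G) : nat -> G :=
  fun m => if Nat.eqb m n then v else e m.

Fixpoint sat {G : Grp} (e : nat -> G) (phi : formula) : Prop :=
  match phi with
  | FEq a b => teval e a = teval e b
  | FFalse => False
  | FNot p => ~ sat e p
  | FAnd p q => sat e p /\ sat e q
  | FOr p q => sat e p \/ sat e q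
  | FImp p q => sat e p -> sat e q
  | FAll n p => forall v : G, sat (upd e n v) p
  | FEx n p => exists v : G, sat (upd e n v) p
  end.

Fixpoint closed_in (bound : list nat) (phi : formula) : Prop :=
  match phi with
  | FEq a b => forall v, In v (tvars a ++ tvars b) -> In v bound
  | FFalse => True
  | FNot p => closed_in bound p
  | FAnd p q | FOr p q | FImp p q => closed_in bound p /\ closed_in bound q
  | FAll n p | FEx n p => closed_in (n :: bound) p
  end.

Definition sentence (phi : formula) : Prop := closed_in [] phi.

Fixpoint quantifier_free (phi : formula) : Prop :=
  match phi with
  | FEq _ _ | FFalse => True
  | FNot p => quantifier_free p
  | FAnd p q | FOr p q | FImp p q => quantifier_free p /\ quantifier_free q
  | FAll _ _ | FEx _ _ => False
  end.

(* G |= phi for a sentence phi (the environment is irrelevant; we use the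
   constant environment at 1). *)
Definition models (G : Grp) (phi : formula) : Prop := @sat G (fun _ => gone) phi.

Definition elem_equiv (G H : Grp) : Prop :=
  forall phi, sentence phi -> (models G phi <-> models H phi).

Definition AE_sentence (phi : formula) : Prop :=
  sentence phi /\
  exists (xs ys : list nat) (theta : formula),
    quantifier_free theta /\
    phi = fold_right FAll (fold_right FEx theta ys) xs.

Definition AE_equiv (G H : Grp) : Prop :=
  forall phi, AE_sentence phi -> (models G phi <-> models H phi).

Definition first_order_rigid (G : Grp) : Prop :=
  forall H : Grp, finitely_generated H -> elem_equiv H G -> isomorphic H G.

(* Main.v *)
(* Since conjugation by [G] acts on [C] by inner automorphisms, there are [a] in [A] and [b] in [B],
   outside [C] and centralizing [C], so that [G = C<t> ∪ C<t>a] with [t = a * b] of infinite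
   order and [a] inverting [t] modulo [C].  Let [N] be twice an exponent of [C].  AE sentences say
   of the [N]-th powers that they have no torsion and that of any two [u], [v], one of [u], [v],
   [u * v] is the square of a third.  An exists-forall sentence names copies of [A] and [B] in [H]
   such that every element of [H] is [c * e] or [c * e * a] up to the copy of [C], with [e] in the
   abelian subgroup [W] centralizing [C] and [t].  As [H] is finitely generated, the [N]-th powers
   of [W] form a finitely generated torsion-free abelian group with at most two classes modulo
   squares, hence an infinite cyclic group, and [W] is generated modulo [C] by one element [s].
   A sentence for all primes [p] saying that [t] is not a [p]-th power is unavailable, but
   non-squareness is enough: it gives [t = s ^ (2 * j + 1)] modulo [C], and replacing the copy of
   [B] by its conjugate under [s ^ j] makes [a * b] equal to [s] modulo [C].  The universal property
   of the amalgam then yields a homomorphism from [G] to [H], which is bijective. *)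
From Stdlib Require Import List Arith ZArith Lia FinFun Classical ClassicalEpsilon ProofIrrelevance.
Require Import Defs.
Import ListNotations.

Declare Scope grp_scope.
Delimit Scope grp_scope with grp.
Bind Scope grp_scope with carrier.
Local Open Scope grp_scope.
Local Infix "*" := gmul : grp_scope.
Local Notation "1" := gone : grp_scope.
Local Notation "x ^-1" := (ginv x) (at level 3, left associativity, format "x ^-1") : grp_scope.

Definition zpow {G : Grp} (x : G) (n : Z) : G :=
  match n with
  | Z0 => 1
  | Zpos p => gpow x (Pos.to_nat p)
  | Zneg p => (gpow x (Pos.to_nat p))^-1
  end.
Arguments zpow {G} x%_grp n%_Z.
Local Infix "^" := zpow : grp_scope.

(** * Groups and integer powers *)

Section GroupBasics.
Variable G : Grp.
Implicit Types x y z : G.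

Lemma mulKV x y : x^-1 * (x * y) = y.
Proof. now rewrite gmul_assoc, gmul_Vl, gmul_1l. Qed.

Lemma mulVK x y : x * (x^-1 * y) = y.
Proof. now rewrite gmul_assoc, gmul_Vr, gmul_1l. Qed.

Lemma mul_cancel_l x y z : x * y = x * z -> y = z.
Proof. intros E; rewrite <- (mulKV x y), E; apply mulKV. Qed.

Lemma mul_cancel_r x y z : y * x = z * x -> y = z.
Proof.
  intros E; rewrite <- (gmul_1r _ y), <- (gmul_1r _ z), <- (gmul_Vr _ x), !gmul_assoc, E.
  reflexivity.
Qed.

Lemma inv_unique x y : x * y = 1 -> y = x^-1.
Proof. intros E; apply (mul_cancel_l x); now rewrite E, gmul_Vr. Qed.

Lemma invK x : x^-1^-1 = x.
Proof. symmetry; apply inv_unique, gmul_Vl. Qed.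

Lemma inv1 : (1 : G)^-1 = 1.
Proof. symmetry; apply inv_unique, gmul_1l. Qed.

Lemma invM x y : (x * y)^-1 = y^-1 * x^-1.
Proof.
  symmetry; apply inv_unique. now rewrite <- gmul_assoc, mulVK, gmul_Vr.
Qed.

End GroupBasics.

#[local] Hint Rewrite <- gmul_assoc : grp.
#[local] Hint Rewrite gmul_1l gmul_1r gmul_Vl gmul_Vr mulKV mulVK invK inv1 invM : grp.
Ltac gsimp := autorewrite with grp.

Definition commute {G : Grp} (x y : G) : Prop := x * y = y * x.

Section Commute.
Variable G : Grp.
Implicit Types x y z : G.

Lemma commute_sym x y : commute x y -> commute y x.
Proof. now unfold commute. Qed.

Lemma commute_refl x : commute x x.
Proof. reflexivity. Qed.

Lemma commute_1 x : commute x 1.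
Proof. unfold commute; now gsimp. Qed.

Lemma commute_mul x y z : commute x y -> commute x z -> commute x (y * z).
Proof.
  unfold commute; intros E F. now rewrite gmul_assoc, E, <- gmul_assoc, F, gmul_assoc.
Qed.

Lemma commute_inv x y : commute x y -> commute x (y^-1).
Proof.
  unfold commute; intros E. apply (mul_cancel_l _ y).
  rewrite gmul_assoc, <- E. now gsimp.
Qed.

Lemma commute_left x y z : commute x y -> x * (y * z) = y * (x * z).
Proof. unfold commute; intros E. now rewrite !gmul_assoc, E. Qed.

Lemma commute_gpow x y n : commute x y -> commute x (gpow y n).
Proof.
  intros E; induction n as [|n IH]; cbn; [apply commute_1 | now apply commute_mul].
Qed.

Lemma commute_zpow x y n : commute x y -> commute x (y ^ n).
Proof.
  intros E; destruct n; cbn; [apply commute_1 | | apply commute_inv];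
    now apply commute_gpow.
Qed.

Lemma zpowN x n : x ^ (- n) = (x ^ n)^-1.
Proof. destruct n; cbn; now gsimp. Qed.

Lemma zpow0 x : x ^ 0 = 1.
Proof. reflexivity. Qed.

Lemma zpow1 x : x ^ 1 = x.
Proof. apply gmul_1r. Qed.

Lemma zpow_of_nat x n : x ^ (Z.of_nat n) = gpow x n.
Proof. destruct n; cbn; [reflexivity | now rewrite SuccNat2Pos.id_succ]. Qed.

Lemma zpow_succ x n : x ^ (n + 1) = x ^ n * x.
Proof.
  destruct (Z_le_gt_dec 0 n) as [Hn|Hn].
  - rewrite <- (Z2Nat.id n Hn); set (k := Z.to_nat n).
    replace (Z.of_nat k + 1)%Z with (Z.of_nat (S k)) by lia.
    rewrite !zpow_of_nat; cbn. apply commute_gpow, commute_refl.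
  - replace (n + 1)%Z with (- Z.of_nat (Z.to_nat (- n - 1)))%Z by lia.
    replace n with (- Z.of_nat (S (Z.to_nat (- n - 1))))%Z at 2 by lia.
    rewrite !zpowN, !zpow_of_nat; cbn. now gsimp.
Qed.

Lemma zpow_pred x n : x ^ (n - 1) = x ^ n * x^-1.
Proof.
  apply (mul_cancel_r _ x). rewrite <- zpow_succ. gsimp. f_equal; lia.
Qed.

Lemma zpow_add x n m : x ^ (n + m) = x ^ n * x ^ m.
Proof.
  revert m; apply Z.peano_ind.
  - rewrite Z.add_0_r; cbn; now gsimp.
  - intros m IH. replace (n + Z.succ m)%Z with (n + m + 1)%Z by lia.
    unfold Z.succ. rewrite !zpow_succ, IH. now gsimp.
  - intros m IH. replace (n + Z.pred m)%Z with (n + m - 1)%Z by lia.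
    replace (Z.pred m) with (m - 1)%Z by lia. rewrite !zpow_pred, IH. now gsimp.
Qed.

Lemma zpow_mul x n m : x ^ (n * m) = (x ^ n) ^ m.
Proof.
  revert m; apply Z.peano_ind.
  - now rewrite Z.mul_0_r.
  - intros m IH. unfold Z.succ. rewrite zpow_succ, <- IH, <- zpow_add. f_equal; lia.
  - intros m IH. replace (Z.pred m) with (m - 1)%Z by lia.
    rewrite zpow_pred, <- IH, <- zpowN, <- zpow_add. f_equal; lia.
Qed.

Lemma zpowV x n : (x^-1) ^ n = (x ^ n)^-1.
Proof.
  rewrite <- (zpow1 x) at 1. rewrite <- zpowN, <- zpow_mul, <- zpowN. f_equal; lia.
Qed.

Lemma zpow_2 x : x ^ 2 = x * x.
Proof. change (x * (x * 1) = x * x). now gsimp. Qed.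

Lemma zpow_one n : (1 : G) ^ n = 1.
Proof.
  revert n; apply Z.peano_ind; [reflexivity| |]; intros n IH.
  - unfold Z.succ. now rewrite zpow_succ, IH, gmul_1l.
  - replace (Z.pred n) with (n - 1)%Z by lia. rewrite zpow_pred, IH. now gsimp.
Qed.

Lemma zpow_mul_commute x y n : commute x y -> (x * y) ^ n = x ^ n * y ^ n.
Proof.
  intros E; revert n; apply Z.peano_ind; [cbn; now gsimp| |]; intros n IH.
  - unfold Z.succ. rewrite !zpow_succ, IH. gsimp.
    now rewrite (commute_left (y ^ n)) by now apply commute_sym, commute_zpow.
  - replace (Z.pred n) with (n - 1)%Z by lia. rewrite !zpow_pred, IH. gsimp.
    rewrite <- (invM _ x y), E, invM.
    now rewrite (commute_left (y ^ n)) by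
      now apply commute_inv, commute_sym, commute_zpow.
Qed.

Lemma zpow_conj x y n : (x * y * x^-1) ^ n = x * y ^ n * x^-1.
Proof.
  revert n; apply Z.peano_ind; [cbn; now gsimp| |]; intros n IH.
  - unfold Z.succ. rewrite !zpow_succ, IH. now gsimp.
  - replace (Z.pred n) with (n - 1)%Z by lia. rewrite !zpow_pred, IH. now gsimp.
Qed.

End Commute.

(** * Subgroups as groups, homomorphisms and isomorphisms *)

Section Subgroups.
Variable G : Grp.
Implicit Types (x y : G) (S : G -> Prop).

Lemma subgroup1 S : subgroup S -> S 1.
Proof. now intros [? _]. Qed.

Lemma subgroupM S x y : subgroup S -> S x -> S y -> S (x * y).
Proof. intros [_ [? _]]; auto. Qed.

Lemma subgroupV S x : subgroup S -> S x -> S (x^-1).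
Proof. intros [_ [_ ?]]; auto. Qed.

Lemma subgroupX S x n : subgroup S -> S x -> S (x ^ n).
Proof.
  intros HS Hx; revert n; apply Z.peano_ind; [exact (subgroup1 _ HS)| |]; intros n IH.
  - unfold Z.succ. rewrite zpow_succ. now apply subgroupM.
  - replace (Z.pred n) with (n - 1)%Z by lia. rewrite zpow_pred.
    apply subgroupM; auto. now apply subgroupV.
Qed.

Lemma subgroup_prod S l : subgroup S -> (forall y, In y l -> S y) -> S (gprod l).
Proof.
  intros HS; induction l as [|y l IH]; intros Hl; cbn; [now apply subgroup1|].
  apply subgroupM; auto; [apply Hl | apply IH; intros; apply Hl]; cbn; auto.
Qed.

Lemma subgroup_powers x : subgroup (fun y => exists n, y = x ^ n).
Proof.
  split; [now exists 0%Z | split].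
  - intros ? ? [n ->] [m ->]; exists (n + m)%Z; symmetry; apply zpow_add.
  - intros ? [n ->]; exists (- n)%Z; symmetry; apply zpowN.
Qed.

Lemma sig_ext (P : G -> Prop) (u v : {x : G | P x}) : proj1_sig u = proj1_sig v -> u = v.
Proof.
  destruct u as [x p], v as [y q]; cbn; intros ->. f_equal; apply proof_irrelevance.
Qed.

(** The universal property of the amalgam and the cyclicity criterion speak of groups, so subgroups
    must become objects of type [Grp]. The definition is transparent so that [val] computes. *)
Definition subgroup_grp S (HS : subgroup S) : Grp.
Proof.
  refine {| carrier := {x : G | S x};
            gmul := fun u v => exist _ (proj1_sig u * proj1_sig v)
                       (subgroupM _ _ _ HS (proj2_sig u) (proj2_sig v));
            gone := exist _ 1 (subgroup1 _ HS);
            ginv := fun u => exist _ ((proj1_sig u)^-1) (subgroupV _ _ HS (proj2_sig u)) |};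
  intros; apply sig_ext; cbn; now gsimp.
Defined.

Definition val {S} {HS : subgroup S} (u : subgroup_grp S HS) : G := proj1_sig u.

Lemma valM S (HS : subgroup S) (u v : subgroup_grp S HS) : val (u * v) = val u * val v.
Proof. reflexivity. Qed.

Lemma valV S (HS : subgroup S) (u : subgroup_grp S HS) : val (u^-1) = (val u)^-1.
Proof. reflexivity. Qed.

End Subgroups.

Section Hom.
Variables (G H : Grp) (f : G -> H).
Hypothesis Hf : is_hom f.

Lemma hom1 : f 1 = 1.
Proof. apply (mul_cancel_l _ (f 1)). rewrite <- Hf. now gsimp. Qed.

Lemma homV x : f (x^-1) = (f x)^-1.
Proof. apply inv_unique. rewrite <- Hf, gmul_Vr. apply hom1. Qed.

Lemma homX x n : f (x ^ n) = f x ^ n.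
Proof.
  revert n; apply Z.peano_ind; [apply hom1| |]; intros n IH.
  - unfold Z.succ. now rewrite !zpow_succ, Hf, IH.
  - replace (Z.pred n) with (n - 1)%Z by lia. now rewrite !zpow_pred, Hf, homV, IH.
Qed.

Lemma subgroup_image : subgroup (fun y => exists x, y = f x).
Proof.
  split; [exists 1; symmetry; apply hom1 | split].
  - intros ? ? [x ->] [y ->]; exists (x * y); symmetry; apply Hf.
  - intros ? [x ->]; exists (x^-1); symmetry; apply homV.
Qed.

(** The isomorphism from [H] to [G] is the inverse of [f], obtained by choice; it is multiplicative
    because [f] is injective. *)
Lemma bijective_hom_isomorphic :
  (forall x, f x = 1 -> x = 1) -> (forall y, exists x, y = f x) -> isomorphic H G.
Proof.
  intros Hinj Hsur.
  assert (inj : forall x y, f x = f y -> x = y).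
  { intros x y E. apply (mul_cancel_r _ (y^-1)). rewrite gmul_Vr. apply Hinj.
    now rewrite Hf, homV, E, gmul_Vr. }
  pose (g := fun y => proj1_sig (constructive_indefinite_description _ (Hsur y))).
  assert (fg : forall y, f (g y) = y).
  { intros y; unfold g; destruct constructive_indefinite_description; cbn; auto. }
  exists g, f; repeat split; auto.
  intros x y; apply inj; now rewrite Hf, !fg.
Qed.

End Hom.

(** * Finitely generated torsion-free abelian groups *)

(** In this form a property of all elements follows as soon as it defines a subgroup containing [l];
    no words in the generators are handled. *)
Definition generates {G : Grp} (l : list G) : Prop :=
  forall S : G -> Prop, subgroup S -> (forall x, In x l -> S x) -> forall x, S x.

Section Cyclic.
Variable M : Grp.
Hypothesis comm : forall x y : M, x * y = y * x.

Fixpoint lin (l : list M) (ns : list Z) : M :=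
  match l, ns with
  | x :: l, n :: ns => x ^ n * lin l ns
  | _, _ => 1
  end.

Lemma comm_zpow (x y : M) n : (x * y) ^ n = x ^ n * y ^ n.
Proof. apply zpow_mul_commute, comm. Qed.

Lemma comm_left (x y z : M) : x * (y * z) = y * (x * z).
Proof. apply commute_left, comm. Qed.

Lemma mul_inv_rearrange (p q x y z : M) :
  p * q = x * (y * z) -> x * p^-1 * (y * q^-1 * z) = 1.
Proof.
  intros E. transitivity (x * (y * z) * (q^-1 * p^-1)); [|rewrite <- E; now gsimp].
  gsimp. rewrite (comm_left (p^-1)), (comm (p^-1)). gsimp. now rewrite (comm_left z).
Qed.

Lemma lin_add l ns ms : length ns = length l -> length ms = length l ->
  exists ks, length ks = length l /\ lin l ks = lin l ns * lin l ms.
Proof.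
  revert ns ms; induction l as [|x l IH]; intros [|n ns] [|m ms]; cbn; try discriminate.
  - exists []; now gsimp.
  - intros E F; injection E as E; injection F as F.
    destruct (IH ns ms E F) as [ks [Hk Ek]].
    exists ((n + m)%Z :: ks); cbn; split; [now rewrite Hk|].
    rewrite zpow_add, Ek; gsimp. now rewrite (comm_left (x ^ m)).
Qed.

Lemma lin_scale l ns k : lin l (map (Z.mul k) ns) = lin l ns ^ k.
Proof.
  revert ns; induction l as [|x l IH]; intros [|n ns]; cbn [lin map];
    rewrite ?zpow_one; try reflexivity.
  now rewrite IH, comm_zpow, <- zpow_mul, Z.mul_comm.
Qed.

Lemma lin_zero l : lin l (map (fun _ => 0%Z) l) = 1.
Proof. induction l; cbn; gsimp; auto. Qed.

Lemma subgroup_lin l :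
  subgroup (fun x => exists ns, length ns = length l /\ x = lin l ns).
Proof.
  split; [|split].
  - exists (map (fun _ => 0%Z) l). now rewrite length_map, lin_zero.
  - intros ? ? [ns [Hn ->]] [ms [Hm ->]].
    destruct (lin_add l ns ms Hn Hm) as [ks [Hk E]]. now exists ks.
  - intros ? [ns [Hn ->]]. exists (map (Z.mul (-1)) ns).
    rewrite length_map, lin_scale. split; auto.
    change (-1)%Z with (- (1))%Z. now rewrite zpowN, zpow1.
Qed.

Lemma lin_in l y : In y l -> exists ns, length ns = length l /\ y = lin l ns.
Proof.
  induction l as [|x l IH]; intros []; [subst|].
  - exists (1%Z :: map (fun _ => 0%Z) l); cbn [lin length].
    rewrite length_map, lin_zero, zpow1. now gsimp.
  - destruct IH as [ns [Hn ->]]; auto. exists (0%Z :: ns); cbn. rewrite Hn. now gsimp.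
Qed.

(* Bezout transformations of the generating list, as in the Smith normal form,
   turn a linear combination into a power of a single generator. *)
Lemma lin_concentrate l ns : l <> [] -> length ns = length l ->
  exists x l' g, length (x :: l') = length l /\
    (forall S : M -> Prop, subgroup S -> (forall y, In y (x :: l') -> S y) ->
       forall y, In y l -> S y) /\
    lin l ns = x ^ g /\ (g = 0%Z -> forall n, In n ns -> n = 0%Z).
Proof.
  revert ns; induction l as [|x l IH]; [easy|]; intros [|n ns] _; [discriminate|].
  intros E; injection E as E.
  destruct l as [|x2 l].
  - destruct ns; [|discriminate]. exists x, [], n; repeat split; auto.
    + cbn; now gsimp.
    + intros -> m [<-|[]]; reflexivity.
  - destruct (IH ns ltac:(easy) E) as (y & l' & g' & Hlen & Hsub & Hlin & Hz).
    change (lin (x :: x2 :: l) (n :: ns)) with (x ^ n * lin (x2 :: l) ns).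
    rewrite Hlin.
    destruct (Z.eq_dec (Z.gcd n g') 0) as [Hg|Hg].
    + apply Z.gcd_eq_0 in Hg as [-> ->].
      exists x, (y :: l'), 0%Z; split; [cbn in *; lia|]; split; [|split].
      * intros S HS Hin z [<-|Hz']; [apply Hin; now left|].
        apply Hsub; auto. intros w Hw; apply Hin; now right.
      * now gsimp.
      * intros _ k [<-|Hk]; auto.
    + set (g := Z.gcd n g') in *.
      destruct (Z.gcd_divide_l n g') as [n' Hn']; destruct (Z.gcd_divide_r n g') as [d Hd].
      fold g in Hn', Hd.
      destruct (Z.gcd_bezout n g' g eq_refl) as (u & v & Huv).
      clearbody g.
      assert (Hb : (u * n' + v * d = 1)%Z).
      { apply (Z.mul_reg_r _ _ g Hg). rewrite Z.mul_add_distr_r, <- !Z.mul_assoc, <- Hn', <- Hd; lia. }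
      (* The exponent matrix with rows [(n', d)] and [(- v, u)] has determinant 1 by [Hb], so [x]
         and [y] are recovered from [x'] and [y']. *)
      set (x' := x ^ n' * y ^ d). set (y' := x ^ (- v) * y ^ u).
      assert (Ex : x = x' ^ u * y' ^ (- d)).
      { unfold x', y'. rewrite !comm_zpow, <- !zpow_mul. gsimp.
        rewrite (comm_left (y ^ (d * u))), gmul_assoc, <- !zpow_add.
        replace (n' * u + - v * - d)%Z with 1%Z by lia.
        replace (d * u + u * - d)%Z with 0%Z by lia. now rewrite zpow1, zpow0, gmul_1r. }
      assert (Ey : y = x' ^ v * y' ^ n').
      { unfold x', y'. rewrite !comm_zpow, <- !zpow_mul. gsimp.
        rewrite (comm_left (y ^ (d * v))), gmul_assoc, <- !zpow_add.
        replace (n' * v + - v * n')%Z with 0%Z by lia.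
        replace (d * v + u * n')%Z with 1%Z by lia. now rewrite zpow1, zpow0, gmul_1l. }
      exists x', (y' :: l'), g; split; [cbn in *; lia|]; split; [|split].
      * intros S HS Hin.
        assert (Sx' : S x') by (apply Hin; now left).
        assert (Sy' : S y') by (apply Hin; right; now left).
        intros z [<-|Hz'].
        -- rewrite Ex. apply subgroupM; auto; now apply subgroupX.
        -- apply Hsub; auto. intros w [<-|Hw].
           ++ rewrite Ey. apply subgroupM; auto; now apply subgroupX.
           ++ apply Hin; right; now right.
      * unfold x'. rewrite comm_zpow, <- !zpow_mul. now f_equal; f_equal.
      * easy.
Qed.

Hypothesis torsion_free : forall (x : M) k, (0 < k)%Z -> x ^ k = 1 -> x = 1.

(** Concentrating a nontrivial relation on one generator [x] gives [x ^ g = 1] with [g] nonzero.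
    Torsion-freeness makes [x] trivial, and the other generators suffice. *)
Lemma relation_shortens l ns : generates l -> length ns = length l -> lin l ns = 1 ->
  (exists n, In n ns /\ n <> 0%Z) -> exists l' : list M, length l' < length l /\ generates l'.
Proof.
  intros Hgen Hlen Hlin [n [Hin Hn]].
  assert (Hl : l <> []) by (intros ->; destruct ns; easy).
  destruct (lin_concentrate l ns Hl Hlen) as (x & l' & g & Hlen' & Hsub & Hx & Hz).
  assert (Hg : g <> 0%Z) by (intros E; apply Hn; auto).
  assert (x1 : x = 1).
  { rewrite Hlin in Hx. destruct (Z_lt_le_dec 0 g) as [Hp|Hp].
    - now apply (torsion_free x g).
    - apply (torsion_free x (- g)); [lia|]. now rewrite zpowN, <- Hx, inv1. }
  exists l'; split; [cbn in Hlen'; lia|].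
  intros S HS Hl'. apply Hgen; auto. apply Hsub; auto.
  intros y [<-|Hy]; auto. rewrite x1; now apply subgroup1.
Qed.

(** Strong induction on the number of generators: as long as there are two, the hypothesis on
    squares applied to them yields a nontrivial relation, and the list can be shortened. *)
Lemma fg_torsion_free_cyclic :
  (forall x y : M, exists z, x = z * z \/ y = z * z \/ x * y = z * z) ->
  (exists l : list M, generates l) ->
  exists p : M, forall x, exists n, x = p ^ n.
Proof.
  intros Hsq [l Hl].
  remember (length l) as k eqn:Hk. revert l Hl Hk.
  induction k as [k IH] using lt_wf_ind; intros l Hl ->.
  destruct l as [|x [|y l]].
  - exists 1. intros x. exists 0%Z.
    apply (Hl (fun x => x = 1)); [|now intros ? []].
    repeat split; [intros ? ? -> ->|intros ? ->]; now gsimp.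
  - exists x. apply Hl; [apply subgroup_powers|].
    intros ? [<-|[]]; exists 1%Z; symmetry; apply zpow1.
  - destruct (Hsq x y) as [z Hz].
    assert (Hij : exists i j, (i = 1 \/ j = 1)%Z /\ x ^ i * y ^ j = z * z).
    { destruct Hz as [Hz|[Hz|Hz]]; rewrite <- Hz.
      - exists 1%Z, 0%Z; split; auto; now rewrite zpow1, zpow0, gmul_1r.
      - exists 0%Z, 1%Z; split; auto; now rewrite zpow1, zpow0, gmul_1l.
      - exists 1%Z, 1%Z; split; auto; now rewrite !zpow1. }
    destruct Hij as (i & j & Hodd & E).
    destruct (Hl _ (subgroup_lin (x :: y :: l)) (lin_in _) z) as [ms [Hms Ez]].
    destruct ms as [|m1 [|m2 ms]]; try discriminate.
    (* Equating [x ^ i * y ^ j] with the square of [z] written in the generators gives this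
       relation; its first two coefficients have the parities of [i] and [j], so one of them is odd
       and hence nonzero. *)
    destruct (relation_shortens (x :: y :: l)
        ((2 * m1 - i)%Z :: (2 * m2 - j)%Z :: map (Z.mul 2) ms)) as [l' [Hlen Hgen]].
    + assumption.
    + cbn in *; now rewrite length_map.
    + cbn [lin] in *. rewrite lin_scale.
      assert (E2 : x ^ i * y ^ j = x ^ (2 * m1) * (y ^ (2 * m2) * lin l ms ^ 2)).
      { rewrite E, <- zpow_2, Ez, !comm_zpow, <- !zpow_mul. f_equal; [f_equal; lia|].
        f_equal; f_equal; lia. }
      unfold Z.sub. rewrite !zpow_add, !zpowN.
      now apply mul_inv_rearrange.
    + destruct Hodd as [->| ->];
        [exists (2 * m1 - 1)%Z | exists (2 * m2 - 1)%Z]; split; cbn [In]; auto; lia.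
    + now apply (IH (length l') Hlen l').
Qed.

End Cyclic.

(** * Transfer of forall-exists sentences *)

Section Satisfaction.

Lemma closed_in_incl phi b b' : incl b b' -> closed_in b phi -> closed_in b' phi.
Proof.
  revert b b'; induction phi; cbn; intros b b' Hb; try tauto.
  - intros Hv v Hin; auto.
  - now apply IHphi.
  - intros []; split; eauto.
  - intros []; split; eauto.
  - intros []; split; eauto.
  - apply IHphi. intros v [<-|Hv]; cbn; auto.
  - apply IHphi. intros v [<-|Hv]; cbn; auto.
Qed.

Lemma closed_in_fold (Q : nat -> formula -> formula) phi xs b :
  Q = FAll \/ Q = FEx -> closed_in (xs ++ b) phi -> closed_in b (fold_right Q phi xs).
Proof.
  intros HQ; revert b; induction xs as [|x xs IH]; cbn; intros b Hc; auto.
  assert (closed_in (x :: b) (fold_right Q phi xs)).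
  { apply IH. revert Hc; apply closed_in_incl.
    intros v; cbn; rewrite !in_app_iff; cbn; tauto. }
  now destruct HQ as [-> | ->].
Qed.

Lemma teval_ext (K : Grp) (e e' : nat -> K) t :
  (forall v, In v (tvars t) -> e v = e' v) -> teval e t = teval e' t.
Proof.
  induction t; cbn; intros He; auto.
  - now rewrite IHt1, IHt2 by (intros; apply He, in_app_iff; auto).
  - now rewrite IHt.
Qed.

Lemma sat_ext phi b (K : Grp) (e e' : nat -> K) : closed_in b phi ->
  (forall v, In v b -> e v = e' v) -> (sat e phi <-> sat e' phi).
Proof.
  revert b e e'; induction phi; cbn [closed_in sat]; intros b e e' Hc He.
  - rewrite (teval_ext K e e' t), (teval_ext K e e' t0); [reflexivity| |];
      intros; apply He, Hc, in_app_iff; auto.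
  - reflexivity.
  - now rewrite (IHphi b e e').
  - destruct Hc; now rewrite (IHphi1 b e e'), (IHphi2 b e e').
  - destruct Hc; now rewrite (IHphi1 b e e'), (IHphi2 b e e').
  - destruct Hc; now rewrite (IHphi1 b e e'), (IHphi2 b e e').
  - assert (E : forall v, sat (upd e n v) phi <-> sat (upd e' n v) phi).
    { intros v; apply (IHphi (n :: b)); auto. intros k Hk; unfold upd.
      destruct (Nat.eqb_spec k n); auto. destruct Hk; [congruence|auto]. }
    split; intros Hs v; apply E, Hs.
  - assert (E : forall v, sat (upd e n v) phi <-> sat (upd e' n v) phi).
    { intros v; apply (IHphi (n :: b)); auto. intros k Hk; unfold upd.
      destruct (Nat.eqb_spec k n); auto. destruct Hk; [congruence|auto]. }
    split; intros [v Hs]; exists v; apply E, Hs.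
Qed.

Lemma upd_same (K : Grp) (e : nat -> K) x v : upd e x v x = v.
Proof. unfold upd; now rewrite Nat.eqb_refl. Qed.

Lemma upd_other (K : Grp) (e : nat -> K) x v i : i <> x -> upd e x v i = e i.
Proof. unfold upd; destruct (Nat.eqb_spec i x); easy. Qed.

Lemma sat_fold_ex (K : Grp) (e : nat -> K) b theta ys : closed_in b theta ->
  sat e (fold_right FEx theta ys) <->
  exists w, (forall i, ~ In i ys -> w i = e i) /\ sat w theta.
Proof.
  intros Hc; revert e; induction ys as [|y ys IH]; cbn [fold_right sat]; intros e.
  - split; [intros Hs; now exists e|].
    intros [w [Hw Hs]]. apply (sat_ext theta b K w); auto.
  - split.
    + intros [v Hv]. apply IH in Hv as [w [Hw Hs]]. exists w; split; auto.
      intros i Hi; cbn in Hi. rewrite Hw, upd_other; auto.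
    + intros [w [Hw Hs]]. exists (w y). apply IH. exists w; split; auto.
      intros i Hi. destruct (Nat.eq_dec i y) as [->|n]; [now rewrite upd_same|].
      rewrite upd_other, Hw; auto. intros [?|?]; auto.
Qed.

Lemma sat_fold_all (K : Grp) (e : nat -> K) b psi xs : closed_in b psi ->
  sat e (fold_right FAll psi xs) <->
  forall w, (forall i, ~ In i xs -> w i = e i) -> sat w psi.
Proof.
  intros Hc; revert e; induction xs as [|x xs IH]; cbn [fold_right sat]; intros e.
  - split; [|intros Hs; now apply Hs].
    intros Hs w Hw. apply (sat_ext psi b K w e); auto.
  - split.
    + intros Hs w Hw. apply (proj1 (IH _) (Hs (w x))).
      intros i Hi. destruct (Nat.eq_dec i x) as [->|n]; [now rewrite upd_same|].
      rewrite upd_other, Hw; auto. intros [?|?]; auto.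
    + intros Hs v. apply IH. intros w Hw. apply Hs.
      intros i Hi; cbn in Hi. rewrite Hw, upd_other; auto.
Qed.

Lemma models_AE (K : Grp) xs ys theta : closed_in (xs ++ ys) theta ->
  models K (fold_right FAll (fold_right FEx theta ys) xs) <->
  forall u : nat -> K, exists w, (forall i, ~ In i ys -> w i = u i) /\ sat w theta.
Proof.
  intros Hc. unfold models.
  assert (Hc' : closed_in (ys ++ (xs ++ ys)) theta).
  { revert Hc; apply closed_in_incl; intros v; rewrite !in_app_iff; tauto. }
  rewrite (sat_fold_all _ _ (xs ++ ys)) by (apply closed_in_fold; auto).
  split; intros Hs u.
  (* The assignment [u] is reset to [1] outside [xs], as the constant environment of [models]
     demands. *)
  - assert (Hs' := Hs (fun i => if in_dec Nat.eq_dec i xs then u i else 1)).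
    rewrite (sat_fold_ex _ _ (xs ++ ys)) in Hs' by exact Hc.
    destruct Hs' as [w [Hw Hsat]].
    { intros i Hi; now destruct in_dec. }
    (* Outside [ys] the values of [u] are restored; this can change only variables that do not occur
       in [theta]. *)
    exists (fun i => if in_dec Nat.eq_dec i ys then w i else u i); split.
    + intros i Hi; now destruct in_dec.
    + apply (sat_ext theta (xs ++ ys) K w); auto.
      intros v Hv. destruct (in_dec Nat.eq_dec v ys) as [|n]; auto.
      rewrite Hw by auto. apply in_app_iff in Hv. now destruct in_dec as [|n']; [|tauto].
  - intros _. rewrite (sat_fold_ex _ _ (xs ++ ys)) by exact Hc. apply Hs.
Qed.

Lemma AE_equiv_sym (G H : Grp) : AE_equiv G H -> AE_equiv H G.
Proof. intros E phi Hphi; symmetry; now apply E. Qed.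

End Satisfaction.

(* Shallow embedding: [qdef P] says that [P K phi x y] is expressible by one
   quantifier-free formula, uniformly in the group [K]; [x], [y] are the variables
   0, 1, and the value of [phi] at the [i]-th entry of [L] is the variable [2 + i]. *)
Section Definability.
Context {I : Type} (L : list I) (idx : I -> nat).
Hypothesis idx_spec : forall g, In g L -> nth_error L (idx g) = Some g.

Definition agree {K : Grp} (phi : I -> K) (x y : K) (e : nat -> K) : Prop :=
  e 0 = x /\ e 1%nat = y /\ forall g, In g L -> e (2 + idx g) = phi g.

Definition bound : list nat := seq 2 (length L) ++ [0; 1]%nat.

Definition qdef (P : forall K : Grp, (I -> K) -> K -> K -> Prop) : Prop :=
  exists theta, quantifier_free theta /\ closed_in bound theta /\
    forall K phi x y e, agree phi x y e -> (sat e theta <-> P K phi x y).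

Definition tdef (f : forall K : Grp, (I -> K) -> K -> K -> K) : Prop :=
  exists t, (forall v, In v (tvars t) -> In v bound) /\
    forall K phi x y e, agree phi x y e -> teval e t = f K phi x y.

Lemma tdef_x : tdef (fun K phi x y => x).
Proof.
  exists (TVar 0); split; [|now intros K phi x y e [? _]].
  intros v [<-|[]]; apply in_app_iff; cbn; auto.
Qed.

Lemma tdef_y : tdef (fun K phi x y => y).
Proof.
  exists (TVar 1); split; [|now intros K phi x y e [_ [? _]]].
  intros v [<-|[]]; apply in_app_iff; cbn; auto.
Qed.

Lemma tdef_val g : In g L -> tdef (fun K phi x y => phi g).
Proof.
  intros Hg; exists (TVar (2 + idx g)); split; [|intros K phi x y e [_ [_ E]]; now apply E].
  intros v [<-|[]]; apply in_app_iff; left. apply in_seq.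
  enough (idx g < length L) by lia. apply nth_error_Some. now rewrite idx_spec.
Qed.

Lemma tdef_1 : tdef (fun K phi x y => 1).
Proof. exists TOne; split; [now intros v []|reflexivity]. Qed.

Lemma tdef_mul f g : tdef f -> tdef g ->
  tdef (fun K phi x y => f K phi x y * g K phi x y).
Proof.
  intros [s [Hs Es]] [t [Ht Et]]; exists (TMul s t); split; cbn.
  - intros v; rewrite in_app_iff; firstorder.
  - intros K phi x y e He. now rewrite (Es K phi x y e He), (Et K phi x y e He).
Qed.

Lemma tdef_inv f : tdef f -> tdef (fun K phi x y => (f K phi x y)^-1).
Proof.
  intros [s [Hs Es]]; exists (TInv s); split; cbn; auto.
  intros K phi x y e He. now rewrite (Es K phi x y e He).
Qed.

Lemma tdef_gpow f n : tdef f -> tdef (fun K phi x y => gpow (f K phi x y) n).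
Proof.
  intros Hf; induction n as [|n IH]; [apply tdef_1 | now apply (tdef_mul f)].
Qed.

Lemma tdef_zpow f n : tdef f -> tdef (fun K phi x y => f K phi x y ^ n).
Proof.
  intros Hf; destruct n; [apply tdef_1 | | apply tdef_inv]; now apply tdef_gpow.
Qed.

Lemma qdef_eq f g : tdef f -> tdef g -> qdef (fun K phi x y => f K phi x y = g K phi x y).
Proof.
  intros [s [Hs Es]] [t [Ht Et]]; exists (FEq s t); split; [easy|split]; cbn.
  - intros v; rewrite in_app_iff; firstorder.
  - intros K phi x y e He. now rewrite (Es K phi x y e He), (Et K phi x y e He).
Qed.

Lemma qdef_not P : qdef P -> qdef (fun K phi x y => ~ P K phi x y).
Proof.
  intros [s [Qs [Cs Es]]]; exists (FNot s); split; [easy|split; [easy|]]; cbn.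
  intros K phi x y e He. now rewrite (Es K phi x y e He).
Qed.

Lemma qdef_and P Q : qdef P -> qdef Q -> qdef (fun K phi x y => P K phi x y /\ Q K phi x y).
Proof.
  intros [s [Qs [Cs Es]]] [t [Qt [Ct Et]]]; exists (FAnd s t); split; [easy|split; [easy|]].
  cbn; intros K phi x y e He. now rewrite (Es K phi x y e He), (Et K phi x y e He).
Qed.

Lemma qdef_or P Q : qdef P -> qdef Q -> qdef (fun K phi x y => P K phi x y \/ Q K phi x y).
Proof.
  intros [s [Qs [Cs Es]]] [t [Qt [Ct Et]]]; exists (FOr s t); split; [easy|split; [easy|]].
  cbn; intros K phi x y e He. now rewrite (Es K phi x y e He), (Et K phi x y e He).
Qed.

Lemma qdef_imp P Q : qdef P -> qdef Q -> qdef (fun K phi x y => P K phi x y -> Q K phi x y).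
Proof.
  intros [s [Qs [Cs Es]]] [t [Qt [Ct Et]]]; exists (FImp s t); split; [easy|split; [easy|]].
  cbn; intros K phi x y e He. now rewrite (Es K phi x y e He), (Et K phi x y e He).
Qed.

(** A condition independent of [K], such as [c <> 1] in the group [G], is decided classically and
    replaced by a true or a false formula. *)
Lemma qdef_const (D : Prop) : qdef (fun K phi x y => D).
Proof.
  destruct (classic D) as [HD|HD]; [exists (FNot FFalse) | exists FFalse];
    repeat split; cbn; tauto.
Qed.

Lemma qdef_iff P Q : (forall K phi x y, P K phi x y <-> Q K phi x y) -> qdef P -> qdef Q.
Proof.
  intros E [s [Qs [Cs Es]]]; exists s; split; [easy|split; [easy|]].
  intros K phi x y e He. now rewrite <- E, (Es K phi x y e He).
Qed.

Lemma qdef_all {J : Type} (S : J -> Prop) P :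
  (exists l, forall j, S j <-> In j l) -> (forall j, S j -> qdef (P j)) ->
  qdef (fun K phi x y => forall j, S j -> P j K phi x y).
Proof.
  intros [l Hl] HP.
  apply (qdef_iff (fun K phi x y => forall j, In j l -> P j K phi x y)).
  { intros K phi x y; split; intros F j Hj; apply F; now apply Hl. }
  assert (HP' : forall j, In j l -> qdef (P j)) by (intros j Hj; now apply HP, Hl).
  clear Hl HP; induction l as [|j l IH].
  - apply (qdef_iff (fun _ _ _ _ => True)); [|apply qdef_const].
    intros; cbn; tauto.
  - apply (qdef_iff (fun K phi x y => P j K phi x y /\
             forall j, In j l -> P j K phi x y)).
    + intros; cbn; split; [intros [? ?] k [<-|?]; auto | auto].
    + apply qdef_and; [apply HP' | apply IH; intros; apply HP']; cbn; auto.
Qed.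

(** A finite disjunction, obtained from [qdef_all] by classical duality. *)
Lemma qdef_ex {J : Type} (S : J -> Prop) P :
  (exists l, forall j, S j <-> In j l) -> (forall j, S j -> qdef (P j)) ->
  qdef (fun K phi x y => exists j, S j /\ P j K phi x y).
Proof.
  intros Hl HP.
  apply (qdef_iff (fun K phi x y => ~ forall j, S j -> ~ P j K phi x y)).
  - intros K phi x y; split.
    + intros F; apply NNPP; intros F'. apply F; intros j Hj HPj. apply F'; now exists j.
    + intros [j [Hj HPj]] F. now apply (F j).
  - apply qdef_not, qdef_all; auto. intros j Hj; apply qdef_not, HP, Hj.
Qed.

(** The values of [phi] on [L] are the universally quantified variables, and [x], [y] the
    existentially quantified ones. *)
Lemma AE_transfer (G H : Grp) P : AE_equiv G H -> qdef P ->
  (forall phi : I -> G, exists x y, P G phi x y) ->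
  forall phi : I -> H, exists x y, P H phi x y.
Proof.
  intros HE [theta [Hqf [Hcl Hs]]] HG phi.
  assert (Hm : models H (fold_right FAll (fold_right FEx theta [0; 1]%nat)
                            (seq 2 (length L)))).
  { apply HE.
    - split; [|now exists (seq 2 (length L)), [0; 1]%nat, theta].
      apply closed_in_fold; auto. apply closed_in_fold; auto.
      revert Hcl; apply closed_in_incl; intros v; unfold bound; rewrite !in_app_iff; tauto.
    - apply models_AE; auto. intros u.
      destruct (HG (fun g => u (2 + idx g))) as [x [y Hxy]].
      exists (fun i => match i with 0 => x | 1%nat => y | _ => u i end); split.
      + intros [|[|i]] Hi; cbn in Hi; tauto.
      + apply (Hs G (fun g => u (2 + idx g)) x y); auto. repeat split. }
  rewrite models_AE in Hm by exact Hcl.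
  destruct (Hm (fun i => match i with
                         | S (S i) => match nth_error L i with
                                      | Some g => phi g | None => 1 end
                         | _ => 1 end)) as [w [Hw Hsat]].
  exists (w 0), (w 1%nat). apply (Hs H phi (w 0) (w 1%nat) w); auto. repeat split.
  intros g Hg. rewrite Hw by (cbn; lia). cbn. now rewrite idx_spec.
Qed.

(** Contraposition: if every [phi] into [H] had a counterexample, [AE_transfer] from [H] to [G] for
    the negated formula would refute the given [phi]. *)
Lemma EA_transfer (G H : Grp) P : AE_equiv H G -> qdef P ->
  (exists phi : I -> G, forall x y, P G phi x y) ->
  exists phi : I -> H, forall x y, P H phi x y.
Proof.
  intros HE HP [phi Hphi]. apply NNPP; intros Hn.
  destruct (AE_transfer H G _ HE (qdef_not P HP)) with (phi := phi) as [x [y Hxy]].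
  - intros psi. apply NNPP; intros Hn'. apply Hn; exists psi; intros x y.
    apply NNPP; intros Hn''. apply Hn'; now exists x, y.
  - now apply Hxy.
Qed.

End Definability.

(** The list may contain repetitions; choice fixes one position for each of its elements. *)
Lemma index_exists {I : Type} (L : list I) :
  exists idx, forall g, In g L -> nth_error L (idx g) = Some g.
Proof.
  apply (ClassicalEpsilon.choice (fun g n => In g L -> nth_error L n = Some g)).
  intros g. destruct (classic (In g L)) as [Hg|Hg]; [|exists 0; tauto].
  apply In_nth_error in Hg as [n Hn]; now exists n.
Qed.

(** * Groups with a normal form c e, c e a *)

Section TwistedProduct.
Variables (K : Grp) (C E : K -> Prop) (a : K).
Hypothesis HC : subgroup C.
Hypothesis HE : subgroup E.
Hypothesis CE : forall c e, C c -> E e -> commute c e.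
Hypothesis Ca : forall c, C c -> commute c a.
Hypothesis Caa : C (a * a).
Hypothesis inverts : forall e, E e -> exists d, C d /\ a * e = d * e^-1 * a.

(** In [G] the subgroup [E] is the group of powers of the translation; in [H] it is [W], or a
    subgroup of [W] when generators are counted. *)
Definition twisted (x : K) : Prop :=
  exists c e, C c /\ E e /\ (x = c * e \/ x = c * e * a).

Lemma twisted_cross c e c' e' : C c -> E e -> C c' -> E e' -> exists d, C d /\
  c * e * a * (c' * e') = c * c' * d * (e * e'^-1) * a.
Proof.
  intros Hc He Hc' He'. destruct (inverts e' He') as [d [Hd Ed]].
  exists d; split; auto. gsimp.
  rewrite <- (commute_left _ c' a) by auto. rewrite Ed. gsimp.
  rewrite <- (commute_left _ c' e), <- (commute_left _ d e) by auto. reflexivity.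
Qed.

(** Moving [a] past the second [e] inverts it modulo [C], so the two factors from [E] cancel, as for
    reflections in a dihedral group. *)
Lemma twisted_square c e : C c -> E e -> C (c * e * a * (c * e * a)).
Proof.
  intros Hc He. destruct (twisted_cross c e c e Hc He Hc He) as [d [Hd Ed]].
  rewrite (gmul_assoc _ _ (c * e)), Ed. gsimp.
  do 3 (apply subgroupM; auto).
Qed.

Lemma subgroup_twisted : subgroup twisted.
Proof.
  split; [|split].
  - exists 1, 1; repeat split; try now apply subgroup1. left; now gsimp.
  - intros ? ? (c & e & Hc & He & [-> | ->]) (c' & e' & Hc' & He' & [-> | ->]).
    + exists (c * c'), (e * e'); repeat split; try now apply subgroupM.
      left; gsimp. now rewrite (commute_left _ c' e) by auto.
    + exists (c * c'), (e * e'); repeat split; try now apply subgroupM.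
      right; gsimp. now rewrite (commute_left _ c' e) by auto.
    + destruct (twisted_cross c e c' e') as [d [Hd ->]]; auto.
      exists (c * c' * d), (e * e'^-1); repeat split; auto;
        repeat apply subgroupM; auto; now apply subgroupV.
    + rewrite (gmul_assoc _ _ (c' * e')).
      destruct (twisted_cross c e c' e') as [d [Hd ->]]; auto.
      assert (He'' : E (e * e'^-1)) by (apply subgroupM; auto; now apply subgroupV).
      exists (c * c' * d * (a * a)), (e * e'^-1); repeat split; auto.
      * do 3 (apply subgroupM; auto).
      * left. rewrite <- (gmul_assoc _ _ (a * a)), (CE (a * a)) by auto. now gsimp.
  - intros ? (c & e & Hc & He & [-> | ->]).
    + exists (c^-1), (e^-1); repeat split; try now apply subgroupV.
      left. rewrite invM. apply commute_sym, CE; now apply subgroupV.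
    (* The inverse of [x] is [(x * x)^-1 * x], where [x * x] lies in [C]; thus only the factor from
       [C] changes. *)
    + set (x := c * e * a).
      exists ((x * x)^-1 * c), e; repeat split; auto.
      * apply subgroupM; auto. apply subgroupV; auto. now apply twisted_square.
      * right. transitivity ((x * x)^-1 * x); [now gsimp|]. unfold x at 3. now gsimp.
Qed.

Lemma twisted_C c : C c -> twisted c.
Proof.
  intros Hc; exists c, 1; repeat split; auto; [now apply subgroup1|].
  left; now gsimp.
Qed.

Lemma twisted_E e : E e -> twisted e.
Proof.
  intros He; exists 1, e; repeat split; auto; [now apply subgroup1|].
  left; now gsimp.
Qed.

Lemma twisted_a : twisted a.
Proof. exists 1, 1; repeat split; try now apply subgroup1. right; now gsimp. Qed.

Lemma twisted_commute_square e : E e -> commute a e -> C (e * e).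
Proof.
  intros He Hae. destruct (inverts e He) as [d [Hd Ed]].
  rewrite Hae in Ed. apply mul_cancel_r in Ed.
  rewrite Ed at 1. now gsimp.
Qed.

End TwistedProduct.

(** * Exponents of finite subgroups and generating lists *)

(** Pigeonhole: among the first [length l + 1] powers of [x] two coincide. *)
Lemma exponent_element (K : Grp) (x : K) (l : list K) :
  (forall n, In (x ^ n) l) -> exists m, (0 < m)%Z /\ x ^ m = 1.
Proof.
  intros Hl. apply NNPP; intros Hn.
  assert (ne : forall i j : nat, i < j -> x ^ Z.of_nat i <> x ^ Z.of_nat j).
  { intros i j Hij E. apply Hn; exists (Z.of_nat j - Z.of_nat i)%Z; split; [lia|].
    unfold Z.sub. now rewrite zpow_add, zpowN, <- E, gmul_Vr. }
  assert (ND : NoDup (map (fun i => x ^ Z.of_nat i) (seq 0 (S (length l))))).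
  { apply Injective_map_NoDup; [|apply seq_NoDup].
    intros i j E. destruct (lt_eq_lt_dec i j) as [[Hij|]|Hij]; auto; exfalso.
    - now apply (ne i j).
    - now apply (ne j i). }
  apply NoDup_incl_length with (l' := l) in ND.
  - rewrite length_map, length_seq in ND. lia.
  - intros y Hy. apply in_map_iff in Hy as [i [<- _]]. apply Hl.
Qed.

Lemma exponent_finite (K : Grp) (S : K -> Prop) : subgroup S -> finite_set S ->
  exists m, (0 < m)%Z /\ forall x, S x -> x ^ m = 1.
Proof.
  intros HS [l Hl].
  assert (Hsub : forall l', incl l' l ->
    exists m, (0 < m)%Z /\ forall x, In x l' -> x ^ m = 1).
  { induction l' as [|y l' IH]; intros Hin.
    - now exists 1%Z.
    - destruct IH as [m [Hm Em]]; [intros z Hz; apply Hin; now right|].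
      destruct (exponent_element K y l) as [k [Hk Ek]].
      { intros n; apply Hl, subgroupX; auto. apply Hl, Hin; now left. }
      exists (k * m)%Z; split; [lia|]. intros z [<-|Hz].
      + now rewrite zpow_mul, Ek, zpow_one.
      + now rewrite Z.mul_comm, zpow_mul, Em, zpow_one. }
  destruct (Hsub l (incl_refl l)) as [m [Hm Em]].
  exists m; split; auto. intros x Hx; now apply Em, Hl.
Qed.

Lemma finitely_generated_generates (K : Grp) :
  finitely_generated K -> exists l : list K, generates l.
Proof.
  intros [l Hl]; exists l. intros S HS Sl x.
  destruct (Hl x) as [w [Hw ->]]. apply subgroup_prod; auto.
  intros y Hy. destruct (Hw y Hy) as [H|H]; auto.
  rewrite <- (invK _ y). apply subgroupV; auto.
Qed.

(** * Groups generated by [C] and two elements with squares in [C] *)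

Section Reflections.
Variables (G : Grp) (C : G -> Prop) (a b : G).
Hypothesis HC : subgroup C.
Hypothesis Ca : forall c, C c -> commute c a.
Hypothesis Cb : forall c, C c -> commute c b.
Hypothesis Caa : C (a * a).
Hypothesis Cbb : C (b * b).
Let t := a * b.
Let T := fun x => exists n, x = t ^ n.

Lemma translation_commute c x : C c -> T x -> commute c x.
Proof. intros Hc [n ->]. apply commute_zpow, commute_mul; auto. Qed.

(** Conjugation by [a] takes [t] to [d * t^-1] with [d = a * a * (b * b)]. Since [d] commutes with
    [t], the power [n] contributes the factor [d ^ n]. *)
Lemma translation_inverts x : T x -> exists d, C d /\ a * x = d * x^-1 * a.
Proof.
  intros [n ->]. set (d := a * a * (b * b)).
  assert (Hd : C d) by now apply subgroupM.
  exists (d ^ n); split; [now apply subgroupX|].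
  apply (mul_cancel_r _ (a^-1)). rewrite <- (gmul_assoc _ _ a), gmul_Vr, gmul_1r.
  rewrite <- zpow_conj, <- zpowN, Z.opp_eq_mul_m1, Z.mul_comm, zpow_mul.
  rewrite <- zpow_mul_commute.
  - f_equal. change (-1)%Z with (- (1))%Z. rewrite zpowN, zpow1. unfold d, t. now gsimp.
  - apply commute_zpow, commute_mul; auto.
Qed.

Hypothesis generated : forall S : G -> Prop, subgroup S ->
  (forall c, C c -> S c) -> S a -> S b -> forall x, S x.

Lemma reflections_normal_form x : twisted G C T a x.
Proof.
  assert (HS : subgroup (twisted G C T a)).
  { apply subgroup_twisted; auto; [apply subgroup_powers | apply translation_commute |
      apply translation_inverts]. }
  assert (HT : subgroup T) by apply subgroup_powers.
  apply generated; auto.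
  - intros; now apply twisted_C.
  - now apply twisted_a.
  - replace b with (a^-1 * t) by (unfold t; now gsimp).
    apply subgroupM; auto; [apply subgroupV; auto; now apply twisted_a|].
    apply twisted_E; auto. exists 1%Z; now rewrite zpow1.
Qed.

(** If a nonzero power of [t] lay in [C], then [t] would have finite order and the normal form would
    leave only finitely many elements. *)
Lemma translation_infinite_order : infinite_group G -> finite_set C ->
  forall n, C (t ^ n) -> n = 0%Z.
Proof.
  intros Hinf Hfin n Hn.
  destruct (exponent_finite G C HC Hfin) as [m [Hm Em]].
  destruct (Z.eq_dec n 0) as [|Hn0]; auto. exfalso; apply Hinf.
  destruct Hfin as [l Hl].
  assert (Hk : t ^ (n * m) = 1) by (rewrite zpow_mul; auto).
  assert (Hnm : (n * m <> 0)%Z) by lia. set (k := (n * m)%Z) in *.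
  exists (flat_map (fun c => flat_map (fun i => [c * t ^ (Z.of_nat i); c * t ^ (Z.of_nat i) * a])
            (seq 0 (Z.abs_nat k))) l).
  intros x; split; [intros _|easy].
  destruct (reflections_normal_form x) as (c & e & Hc & [j ->] & Hx).
  apply in_flat_map; exists c; split; [now apply Hl|].
  apply in_flat_map; exists (Z.to_nat (j mod Z.abs k)).
  pose proof (Z.mod_pos_bound j (Z.abs k)).
  split; [apply in_seq; lia|]. rewrite Z2Nat.id by lia.
  replace (t ^ (j mod Z.abs k)) with (t ^ j); [destruct Hx; cbn; auto|].
  rewrite (Z.div_mod j (Z.abs k)) at 1 by lia.
  assert (Hk' : t ^ Z.abs k = 1).
  { destruct (Z.abs_eq_or_opp k) as [-> | ->]; auto. now rewrite zpowN, Hk, inv1. }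
  now rewrite zpow_add, zpow_mul, Hk', zpow_one, gmul_1l.
Qed.

End Reflections.

(** * Amalgams over subgroups of index two *)

Section Amalgam.
Variables (G : Grp) (A B C : G -> Prop).

(** The universal property gives a homomorphism from [G] to [S]. Followed by the inclusion it agrees
    with the identity on [A] and [B], so by uniqueness it is the identity. *)
Lemma amalgam_generated (S : G -> Prop) : amalgam_decomp G A B C -> subgroup S ->
  (forall x, A x -> S x) -> (forall x, B x -> S x) -> forall x, S x.
Proof.
  intros (HA & HB & HC & Huniv) HS SA SB.
  (* The universal property takes total functions, so [f] gets the value [1] outside [S]. *)
  pose (f := fun x : G => match excluded_middle_informative (S x) with
               | left Hx => exist _ x Hx : subgroup_grp G S HS
               | right _ => 1 end).
  assert (vf : forall x, S x -> val G (f x) = x).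
  { intros x Hx; unfold f; now destruct excluded_middle_informative. }
  assert (fM : forall x y, S x -> S y -> f (x * y) = f x * f y).
  { intros x y Hx Hy. apply sig_ext. change (val G (f (x * y)) = val G (f x) * val G (f y)).
    rewrite !vf; auto. now apply subgroupM. }
  destruct (Huniv (subgroup_grp G S HS) f f) as [[h (Hh & hA & hB)] _]; auto.
  destruct (Huniv G (fun x => x) (fun x => x)) as [_ Hu]; auto.
  intros x. enough (E : val G (h x) = x) by (rewrite <- E; apply (proj2_sig (h x))).
  apply (Hu (fun x => val G (h x)) (fun x => x)); try (now intros y Hy).
  - intros y z. now rewrite Hh.
  - intros y Hy; rewrite hA, vf; auto.
  - intros y Hy; rewrite hB, vf; auto.
Qed.

(* [K] is normal in [A], so any [a0] in the nontrivial coset conjugates [K] like some [d] in [K];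
   then [d^-1 * a0] centralizes [K]. *)
Lemma index2_centralizing (K : G -> Prop) : has_index A K 2 -> normalizer_image_inner K ->
  exists a, A a /\ (forall c, K c -> commute c a) /\ K (a * a) /\
    forall x, A x -> K x \/ exists c, K c /\ x = a * c.
Proof.
  intros (HA & HK & KA & l & Hl & lA & linj & lsur) Hinn.
  destruct l as [|u [|v [|]]]; try discriminate.
  assert (Ha0 : exists a, A a /\ ~ K a).
  { destruct (classic (K u)) as [Ku|Ku]; [|exists u; split; auto; apply lA; now left].
    exists v; split; [apply lA; right; now left|]. intros Kv.
    enough (0 = 1)%nat by discriminate. apply linj; try lia; cbn.
    apply subgroupM; auto. now apply subgroupV. }
  destruct Ha0 as (a0 & Aa0 & Ka0).
  assert (same : forall x, A x -> ~ K x -> K (a0^-1 * x)).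
  { intros x Ax Kx.
    assert (diff : forall i y z, i < 2 -> K ((nth i [u; v] 1)^-1 * y) ->
              K ((nth i [u; v] 1)^-1 * z) -> K (y^-1 * z)).
    { intros i y z _ Hy Hz. replace (y^-1 * z) with
        (((nth i [u; v] 1)^-1 * y)^-1 * ((nth i [u; v] 1)^-1 * z)) by now gsimp.
      apply subgroupM; auto. now apply subgroupV. }
    destruct (lsur x Ax) as (i & Hi & Ki), (lsur a0 Aa0) as (j & Hj & Kj).
    destruct (lsur 1 (subgroup1 _ _ HA)) as (k & Hk & Kk).
    assert (i <> k).
    { intros ->. apply Kx. rewrite <- (gmul_1l _ x), <- (inv1 G). now apply (diff k). }
    assert (j <> k).
    { intros ->. apply Ka0. rewrite <- (gmul_1l _ a0), <- (inv1 G). now apply (diff k). }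
    (* Both indices are below 2 and differ from the index [k] of the coset of [1]. *)
    assert (i = j) by lia. subst j. now apply (diff i). }
  assert (cosets : forall x, A x -> K x \/ exists c, K c /\ x = a0 * c).
  { intros x Ax. destruct (classic (K x)) as [|Kx]; auto. right.
    exists (a0^-1 * x); split; auto. now rewrite mulVK. }
  assert (Kmul : forall c, K c -> K (a0 * c) -> False).
  { intros c Hc Hac. apply Ka0. replace a0 with (a0 * c * c^-1) by now gsimp.
    apply subgroupM; auto. now apply subgroupV. }
  assert (Ksq : K (a0 * a0)).
  { destruct (cosets (a0 * a0)) as [|(c & Hc & E)]; auto; [now apply subgroupM|].
    apply mul_cancel_l in E. now subst. }
  assert (norm : normalizes K a0).
  { assert (Hcj : forall c, K c -> K (a0 * c * a0^-1)).
    { intros c Hc. destruct (cosets (a0 * c * a0^-1)) as [|(d & Hd & E)]; auto.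
      - repeat apply subgroupM; auto. now apply subgroupV.
      - rewrite <- gmul_assoc in E. apply mul_cancel_l in E.
        exfalso; apply Ka0. rewrite <- (invK _ a0). apply subgroupV; auto.
        replace (a0^-1) with (c^-1 * (c * a0^-1)) by now gsimp.
        apply subgroupM; auto; [now apply subgroupV | now rewrite E]. }
    intros c; split; auto. intros Hc.
    (* The converse half of normality: conjugating once more by [a0] and then undoing conjugation by
       [a0 * a0], an element of [K], recovers [c]. *)
    replace c with ((a0 * a0)^-1 * (a0 * (a0 * c * a0^-1) * a0^-1) * (a0 * a0)) by now gsimp.
    apply subgroupM; auto. apply subgroupM; auto. now apply subgroupV. }
  destruct (Hinn a0 norm) as (d & Hd & Ed).
  assert (Ad : A (d^-1 * a0)) by (apply subgroupM; auto; apply subgroupV; auto).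
  assert (cent : forall c, K c -> commute c (d^-1 * a0)).
  { intros c Hc. specialize (Ed c Hc). unfold commute. apply (mul_cancel_l _ d).
    apply (mul_cancel_r _ (a0^-1)). gsimp. rewrite <- !gmul_assoc in Ed. now rewrite Ed. }
  exists (d^-1 * a0). split; [|split; [|split]]; auto.
  - replace (d^-1 * a0 * (d^-1 * a0)) with (d^-1 * (a0 * d^-1 * a0^-1) * (a0 * a0))
      by now gsimp.
    apply subgroupM; auto. apply subgroupM; auto; [now apply subgroupV|].
    apply (proj1 (norm _)). now apply subgroupV.
  - intros x Ax. destruct (cosets x Ax) as [|(c & Hc & ->)]; auto. right.
    exists (d * c); split; [now apply subgroupM|].
    rewrite gmul_assoc, <- (cent d) by auto. now gsimp.
Qed.

End Amalgam.

(** * The sentences to transfer *)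

Section NamedTheory.
Variables (G : Grp) (A B C : G -> Prop) (a b : G) (N : Z).

(** Being a power of [a * b] modulo [C] is an infinite disjunction. Centralizing [C] and [a * b] is
    a finite conjunction, and in [G] it implies the former. *)
Definition centralizes {K : Grp} (phi : G -> K) (x : K) : Prop :=
  (forall c, C c -> x * phi c = phi c * x) /\ x * (phi a * phi b) = phi a * phi b * x.

(* True in [G] for [phi := id] and all [x], [y], these conditions form a quantifier-free formula
   about the finitely many values of [phi] on [A] and [B] and about [x], [y]: an
   exists-forall sentence carries them to [H].  The last clause, that the translation [a * b]
   is not a square modulo [C], is all that is needed of its primitivity. *)
Definition named_theory (K : Grp) (phi : G -> K) (x y : K) : Prop :=
  (forall g, A g -> forall h, A h -> phi (g * h) = phi g * phi h) /\
  (forall g, B g -> forall h, B h -> phi (g * h) = phi g * phi h) /\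
  (forall c, C c -> c <> 1 -> phi c <> 1) /\
  (phi a * phi b) ^ N <> 1 /\
  (exists c, C c /\
     (centralizes phi (phi c * x) \/ centralizes phi (phi c * x * phi a))) /\
  (centralizes phi x -> centralizes phi y -> x * y = y * x) /\
  (centralizes phi x -> x ^ N = 1 -> exists c, C c /\ x = phi c) /\
  (centralizes phi x -> exists c, C c /\ phi a * x = phi c * x^-1 * phi a) /\
  (forall c, C c -> x * x <> phi c * (phi a * phi b)).

Hypotheses (HA : subgroup A) (HB : subgroup B).
Hypotheses (finA : finite_set A) (finB : finite_set B) (finC : finite_set C).
Hypotheses (CA : forall c, C c -> A c) (Aa : A a) (Bb : B b).

Section Definable.
Variables (L : list G) (idx : G -> nat).
Hypothesis idx_spec : forall g, In g L -> nth_error L (idx g) = Some g.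
Hypotheses (AL : forall g, A g -> In g L) (BL : forall g, B g -> In g L).

Let tval g : In g L -> tdef L idx (fun K phi x y => phi g).
Proof. now apply tdef_val. Qed.

Lemma tdef_t : tdef L idx (fun K phi x y => phi a * phi b).
Proof. apply tdef_mul; auto. Qed.

Lemma qdef_centralizes f : tdef L idx f ->
  qdef L idx (fun K phi x y => centralizes phi (f K phi x y)).
Proof.
  intros Hf. unfold centralizes. apply qdef_and.
  - apply qdef_all; auto. intros c Hc. apply qdef_eq; apply tdef_mul; auto.
  - apply qdef_eq; apply tdef_mul; auto using tdef_t.
Qed.

Lemma qdef_named_theory : qdef L idx named_theory.
Proof.
  pose proof (tdef_x L idx) as Hx. pose proof (tdef_y L idx) as Hy.
  pose proof tdef_t as Ht. pose proof (qdef_centralizes _ Hx) as Hcx.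
  unfold named_theory. repeat apply qdef_and.
  - apply qdef_all; auto; intros g Hg. apply qdef_all; auto; intros h Hh.
    apply qdef_eq; [apply tval, AL; now apply subgroupM | apply tdef_mul; auto].
  - apply qdef_all; auto; intros g Hg. apply qdef_all; auto; intros h Hh.
    apply qdef_eq; [apply tval, BL; now apply subgroupM | apply tdef_mul; auto].
  - apply qdef_all; auto; intros c Hc. apply qdef_imp; [apply qdef_const|].
    apply qdef_not, qdef_eq; auto using tdef_1.
  - apply qdef_not, qdef_eq; auto using tdef_1. now apply tdef_zpow.
  - apply qdef_ex; auto; intros c Hc.
    apply qdef_or; apply qdef_centralizes; repeat apply tdef_mul; auto.
  - repeat apply qdef_imp; auto; [now apply qdef_centralizes|].
    apply qdef_eq; apply tdef_mul; auto.
  - repeat apply qdef_imp; auto.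
    + apply qdef_eq; auto using tdef_1, tdef_zpow.
    + apply qdef_ex; auto; intros c Hc. apply qdef_eq; auto.
  - apply qdef_imp; auto. apply qdef_ex; auto; intros c Hc.
    apply qdef_eq; repeat apply tdef_mul; auto using tdef_inv.
  - apply qdef_all; auto; intros c Hc. apply qdef_not, qdef_eq; apply tdef_mul; auto.
Qed.

End Definable.

Lemma named_theory_transfer (H : Grp) : AE_equiv H G ->
  (forall x y, named_theory G (fun g => g) x y) ->
  exists phi : G -> H, forall x y, named_theory H phi x y.
Proof.
  intros HE HG. destruct finA as [lA HlA], finB as [lB HlB].
  destruct (index_exists (lA ++ lB)) as [idx Hidx].
  apply (EA_transfer (lA ++ lB) idx Hidx G H); auto; [|now exists (fun g => g)].
  apply qdef_named_theory; auto; intros g Hg; apply in_app_iff; [left; now apply HlA|].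
  right; now apply HlB.
Qed.

End NamedTheory.

(** * Transfer of the sentences about powers *)

(** A universal sentence for each single [k], seen as an exists-forall sentence with an empty list
    of named values. *)
Lemma power_torsion_transfer (G H : Grp) (N k : Z) : AE_equiv H G ->
  (forall x : G, (x ^ N) ^ k = 1 -> x ^ N = 1) ->
  forall x : H, (x ^ N) ^ k = 1 -> x ^ N = 1.
Proof.
  intros HE HG. destruct (index_exists (@nil nat)) as [idx Hidx].
  destruct (EA_transfer [] idx Hidx G H
    (fun K phi x y => (x ^ N) ^ k = 1 -> x ^ N = 1)) as [phi Hphi].
  - exact HE.
  - pose proof (tdef_x (@nil nat) idx) as Hx.
    apply qdef_imp; apply qdef_eq; auto using tdef_1, tdef_zpow.
  - exists (fun _ => 1); intros x _; apply HG.
  - intros x; now apply (Hphi x 1).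
Qed.

(** The two universal variables are the values of [phi] at [true] and [false]. *)
Lemma power_square_transfer (G H : Grp) (N : Z) : AE_equiv H G ->
  (forall x y : G, exists z,
     x ^ N = z ^ N * z ^ N \/ y ^ N = z ^ N * z ^ N \/ x ^ N * y ^ N = z ^ N * z ^ N) ->
  forall x y : H, exists z,
     x ^ N = z ^ N * z ^ N \/ y ^ N = z ^ N * z ^ N \/ x ^ N * y ^ N = z ^ N * z ^ N.
Proof.
  intros HE HG x y. destruct (index_exists [true; false]) as [idx Hidx].
  destruct (AE_transfer [true; false] idx Hidx G H
    (fun K phi z _ => phi true ^ N = z ^ N * z ^ N \/ phi false ^ N = z ^ N * z ^ N \/
                      phi true ^ N * phi false ^ N = z ^ N * z ^ N))
    with (phi := fun i : bool => if i then x else y) as [z [_ Hz]].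
  - now apply AE_equiv_sym.
  - assert (Hd : forall i, tdef [true; false] idx (fun K phi x y => phi i)).
    { intros i; apply tdef_val; auto. destruct i; cbn; auto. }
    assert (Hz : tdef [true; false] idx (fun K phi z _ => z ^ N * z ^ N)).
    { apply tdef_mul; apply tdef_zpow, tdef_x. }
    repeat apply qdef_or; apply qdef_eq; auto using tdef_zpow, tdef_mul.
  - intros phi. destruct (HG (phi true) (phi false)) as [z Hz]. now exists z, 1.
  - now exists z.
Qed.

(** * Truth of the transferred sentences in [G] *)

Section ReflectionsSatisfyTheory.
Variables (G : Grp) (A B C : G -> Prop) (a b : G) (m : Z).
Hypothesis HC : subgroup C.
Hypothesis Ca : forall c, C c -> commute c a.
Hypothesis Cb : forall c, C c -> commute c b.
Hypothesis Caa : C (a * a).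
Hypothesis Cbb : C (b * b).
Let t := a * b.
Let T := fun x => exists n, x = t ^ n.
Hypothesis normal_form : forall x, twisted G C T a x.
Hypothesis order_t : forall n, C (t ^ n) -> n = 0%Z.
Hypothesis m_pos : (0 < m)%Z.
Hypothesis exponent : forall c, C c -> c ^ m = 1.
(** The factor 2 brings elements [c * e * a] into [C], where the exponent [m] kills them. *)
Let N := (2 * m)%Z.

Let HT : subgroup T. Proof. apply subgroup_powers. Qed.
Let CT : forall c e, C c -> T e -> commute c e.
Proof. now apply translation_commute. Qed.
Let inverts : forall e, T e -> exists d, C d /\ a * e = d * e^-1 * a.
Proof. now apply translation_inverts. Qed.

Let N_pos : (0 < N)%Z. Proof. unfold N; lia. Qed.

Lemma translation_order n k : t ^ n = t ^ k -> n = k.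
Proof.
  intros E. enough (n - k = 0)%Z by lia. apply order_t.
  unfold Z.sub. rewrite zpow_add, zpowN, E, gmul_Vr. now apply subgroup1.
Qed.

Lemma power_translation (x : G) : exists i, x ^ N = t ^ (i * N).
Proof.
  destruct (normal_form x) as (c & e & Hc & He & [-> | ->]).
  - assert (HcN : c ^ N = 1) by (unfold N; rewrite Z.mul_comm, zpow_mul, exponent; auto;
      apply zpow_one).
    rewrite zpow_mul_commute, HcN by auto. destruct He as [n ->]. exists n.
    now rewrite gmul_1l, <- zpow_mul.
  - exists 0%Z. unfold N. rewrite zpow_mul, zpow_2. apply exponent.
    now apply (twisted_square G C T).
Qed.

Lemma power_torsion k (x : G) : k <> 0%Z -> (x ^ N) ^ k = 1 -> x ^ N = 1.
Proof.
  intros Hk. destruct (power_translation x) as [i ->]. rewrite <- zpow_mul.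
  intros E. assert (i * N * k = 0)%Z by (apply translation_order; now rewrite E).
  assert (i = 0%Z) as -> by (apply Z.mul_eq_0 in H as [H|]; nia). reflexivity.
Qed.

(** The [N]-th powers are the powers of [t ^ N], and of two integers [i], [j] one of [i], [j],
    [i + j] is even. *)
Lemma power_square (x y : G) : exists z,
  x ^ N = z ^ N * z ^ N \/ y ^ N = z ^ N * z ^ N \/ x ^ N * y ^ N = z ^ N * z ^ N.
Proof.
  destruct (power_translation x) as [i ->], (power_translation y) as [j ->].
  assert (D : forall k n, (n = (k + k) * N)%Z -> t ^ n = (t ^ k) ^ N * (t ^ k) ^ N).
  { intros k n ->. rewrite <- !zpow_mul, <- zpow_add. f_equal; lia. }
  destruct (Z.Even_or_Odd i) as [[k ->]|[k ->]].
  { exists (t ^ k); left. apply D; lia. }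
  destruct (Z.Even_or_Odd j) as [[l ->]|[l ->]].
  { exists (t ^ l); right; left. apply D; lia. }
  exists (t ^ (k + l + 1)); right; right. rewrite <- zpow_add. apply D; lia.
Qed.

Lemma translation_not_fixed : a * t <> t * a.
Proof.
  intros E. assert (C (t * t)).
  { apply (twisted_commute_square G C T a); auto. exists 1%Z; now rewrite zpow1. }
  rewrite <- zpow_2 in H. now apply order_t in H.
Qed.

(** An element [c * t ^ n * a] commuting with [t] would make [a] commute with [t], hence put [t * t]
    into [C]. *)
Lemma centralizer_translation x : centralizes G C a b (fun g => g) x ->
  exists c n, C c /\ x = c * t ^ n.
Proof.
  intros [_ Hx]. destruct (normal_form x) as (c & e & Hc & [n ->] & [-> | ->]);
    [now exists c, n|].
  exfalso; apply translation_not_fixed. fold t in Hx.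
  apply (mul_cancel_l _ (c * t ^ n)). rewrite gmul_assoc, Hx, !gmul_assoc. f_equal.
  rewrite <- gmul_assoc.
  apply commute_mul; [|apply commute_zpow, commute_refl].
  apply commute_sym, CT; auto. exists 1%Z; now rewrite zpow1.
Qed.

Lemma translation_centralizes n : centralizes G C a b (fun g => g) (t ^ n).
Proof.
  split.
  - intros c Hc. apply commute_sym, CT; auto. now exists n.
  - apply commute_sym, commute_zpow, commute_refl.
Qed.

Lemma reflections_named_theory (x y : G) : named_theory G A B C a b N G (fun g => g) x y.
Proof.
  unfold named_theory. fold t. repeat split; auto.
  - intros E. assert (N = 0%Z) by now apply translation_order. lia.
  - destruct (normal_form x) as (c & e & Hc & [n ->] & [-> | ->]).
    + exists (c^-1); split; [now apply subgroupV|left]. rewrite mulKV.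
      apply translation_centralizes.
    + exists ((a * a)^-1 * c^-1); split; [apply subgroupM; auto; now apply subgroupV|right].
      replace ((a * a)^-1 * c^-1 * (c * t ^ n * a) * a) with ((a * a)^-1 * (t ^ n * (a * a)))
        by now gsimp.
      rewrite <- (CT (a * a)), mulKV; auto; [apply translation_centralizes | now exists n].
  - intros Hx Hy. destruct (centralizer_translation y Hy) as (c & n & Hc & ->).
    apply commute_mul; [now apply Hx | apply commute_zpow, Hx].
  - intros Hx E. destruct (centralizer_translation x Hx) as (c & n & Hc & ->).
    exists c; split; auto.
    assert (HcN : c ^ N = 1) by (unfold N; rewrite Z.mul_comm, zpow_mul, exponent; auto;
      apply zpow_one).
    rewrite zpow_mul_commute, HcN, gmul_1l, <- zpow_mul in E by (apply CT; auto; now exists n).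
    assert (n * N = 0)%Z by now apply translation_order.
    assert (n = 0%Z) by nia. subst. now rewrite zpow0, gmul_1r.
  - intros Hx. destruct (centralizer_translation x Hx) as (c & n & Hc & ->).
    assert (Ht : T (t ^ n)) by now exists n.
    destruct (inverts (t ^ n) Ht) as (d & Hd & Ed).
    exists (c * d * c); split; [repeat apply subgroupM; auto|].
    rewrite (gmul_assoc _ a), <- (Ca c), <- gmul_assoc, Ed, invM by auto. gsimp.
    rewrite <- (commute_left _ (c^-1)); [now gsimp|].
    apply CT; [now apply subgroupV | now apply subgroupV].
  (* Non-squareness: for [x = d * t ^ n] the odd power [t ^ (n * 2 - 1)] would lie in [C]; otherwise
     [x * x] lies in [C], and so would [t]. *)
  - intros c Hc E. destruct (normal_form x) as (d & e & Hd & [n ->] & [-> | ->]).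
    + rewrite <- zpow_2, zpow_mul_commute, <- zpow_mul in E by (apply CT; auto; now exists n).
      enough (n * 2 - 1 = 0)%Z by lia. apply order_t.
      rewrite zpow_pred.
      replace (t ^ (n * 2)) with ((d ^ 2)^-1 * (c * t)) by (rewrite <- E; now gsimp).
      gsimp.
      apply subgroupM; auto. apply subgroupV; auto. now apply subgroupX.
    + enough (1 = 0)%Z by lia. apply order_t. rewrite zpow1.
      replace t with (c^-1 * (c * t)) by now gsimp. rewrite <- E.
      apply subgroupM; auto; [now apply subgroupV|].
      apply (twisted_square G C T); auto. now exists n.
Qed.

End ReflectionsSatisfyTheory.

(** * Finitely generated models *)

Section Model.
Variables (G : Grp) (A B C : G -> Prop) (a b : G) (N : Z).
Hypotheses (HA : subgroup A) (HB : subgroup B) (HC : subgroup C).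
Hypotheses (CA : forall c, C c -> A c) (CB : forall c, C c -> B c).
Hypotheses (Aa : A a) (Bb : B b) (Caa : C (a * a)).
Hypothesis Ca : forall c, C c -> commute c a.
Hypothesis Cb : forall c, C c -> commute c b.
Hypothesis exponent : forall c, C c -> c ^ N = 1.
Variables (H : Grp) (phi : G -> H).
Hypothesis Hax : forall x y, named_theory G A B C a b N H phi x y.
Hypothesis power_torsion_H : forall k (x : H), k <> 0%Z -> (x ^ N) ^ k = 1 -> x ^ N = 1.
Hypothesis power_square_H : forall x y : H, exists z,
  x ^ N = z ^ N * z ^ N \/ y ^ N = z ^ N * z ^ N \/ x ^ N * y ^ N = z ^ N * z ^ N.
Hypothesis generated_H : exists l : list H, generates l.

Let t := phi a * phi b.
Let D := fun x => exists c, C c /\ x = phi c.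
Let W := centralizes G C a b phi.

Let phiA g h : A g -> A h -> phi (g * h) = phi g * phi h.
Proof. destruct (Hax 1 1) as [Hx _]; auto. Qed.

Let phiB g h : B g -> B h -> phi (g * h) = phi g * phi h.
Proof. destruct (Hax 1 1) as (_ & Hx & _); auto. Qed.

Let phi_inj c : C c -> phi c = 1 -> c = 1.
Proof.
  destruct (Hax 1 1) as (_ & _ & Hx & _). intros Hc E; apply NNPP; intros n.
  now apply (Hx c).
Qed.

Let t_order : t ^ N <> 1.
Proof. now destruct (Hax 1 1) as (_ & _ & _ & Hx & _). Qed.

Let phi_1 : phi 1 = 1.
Proof.
  apply (mul_cancel_l _ (phi 1)).
  rewrite <- phiA by now apply subgroup1. now rewrite !gmul_1r.
Qed.

Let phi_V c : C c -> phi (c^-1) = (phi c)^-1.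
Proof.
  intros Hc. apply inv_unique. rewrite <- phiA, gmul_Vr; auto.
  now apply CA, subgroupV.
Qed.

(** [phi] is multiplicative on [A] and on [B] only, so the rule for powers under homomorphisms is
    applied to its restriction to [C]. *)
Let phi_X c n : C c -> phi (c ^ n) = phi c ^ n.
Proof.
  intros Hc.
  pose (v := fun u : subgroup_grp G C HC => val G u).
  assert (Hv : is_hom v) by (intros ? ?; reflexivity).
  assert (Hp : is_hom (fun u => phi (v u))).
  { intros x y. rewrite Hv. apply phiA; apply CA; [exact (proj2_sig x) | exact (proj2_sig y)]. }
  set (u := exist _ c Hc : subgroup_grp G C HC).
  change c with (v u). rewrite <- homX; auto. exact (homX _ _ _ Hp u n).
Qed.

Let D_subgroup : subgroup D.
Proof.
  split; [exists 1; split; auto; now apply subgroup1 | split].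
  - intros ? ? [c [Hc ->]] [d [Hd ->]]. exists (c * d); split; [now apply subgroupM|].
    rewrite phiA; auto.
  - intros ? [c [Hc ->]]. exists (c^-1); split; [now apply subgroupV|]. now rewrite phi_V.
Qed.

Let D_exponent x : D x -> x ^ N = 1.
Proof. intros [c [Hc ->]]. now rewrite <- phi_X, exponent. Qed.

Let D_a x : D x -> commute x (phi a).
Proof. intros [c [Hc ->]]. red. rewrite <- !phiA; auto. f_equal; now apply Ca. Qed.

Let D_b x : D x -> commute x (phi b).
Proof. intros [c [Hc ->]]. red. rewrite <- !phiB; auto. f_equal; now apply Cb. Qed.

Let D_aa : D (phi a * phi a).
Proof. exists (a * a); split; auto. now rewrite phiA. Qed.

Let W_subgroup : subgroup W.
Proof.
  assert (E : forall x, W x <-> (forall c, C c -> commute (phi c) x) /\ commute t x).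
  { intros x; unfold W, centralizes, commute, t. split.
    - intros [E1 E2]; split; [intros c Hc; symmetry; auto | easy].
    - intros [E1 E2]; split; [intros c Hc; symmetry; auto | easy]. }
  split; [|split].
  - apply E; split; intros; apply commute_1.
  - intros x y Hx Hy; apply E in Hx as [], Hy as []; apply E; split; intros;
      apply commute_mul; auto.
  - intros x Hx; apply E in Hx as []; apply E; split; intros; apply commute_inv; auto.
Qed.

Let DW c x : D c -> W x -> commute c x.
Proof. intros [d [Hd ->]] [Hx _]. symmetry; now apply Hx. Qed.

Let W_t : W t.
Proof.
  split; [|reflexivity]. intros c Hc. symmetry. apply commute_mul; [apply D_a|apply D_b];
    now exists c.
Qed.

Let W_comm x y : W x -> W y -> x * y = y * x.
Proof. destruct (Hax x y) as (_ & _ & _ & _ & _ & Hx & _); auto. Qed.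

Let W_torsion x : W x -> x ^ N = 1 -> D x.
Proof. destruct (Hax x x) as (_ & _ & _ & _ & _ & _ & Hx & _); auto. Qed.

Let W_inverts x : W x -> exists d, D d /\ phi a * x = d * x^-1 * phi a.
Proof.
  destruct (Hax x x) as (_ & _ & _ & _ & _ & _ & _ & Hx & _). intros Zx.
  destruct (Hx Zx) as (c & Hc & E). exists (phi c); split; auto. now exists c.
Qed.

(** The theory puts [phi c * x] or [phi c * x * phi a] into [W]; as the twisted elements form a
    subgroup containing [W], [D] and [phi a], the factors can be removed. *)
Let H_normal_form x : twisted H D W (phi a) x.
Proof.
  destruct (Hax x x) as (_ & _ & _ & _ & (c & Hc & Hx) & _).
  assert (Dc : D (phi c)) by now exists c.
  assert (HS : subgroup (twisted H D W (phi a))) by now apply subgroup_twisted.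
  assert (Da : twisted H D W (phi a) (phi a)) by now apply twisted_a.
  assert (Dc' : twisted H D W (phi a) (phi c)) by now apply twisted_C.
  destruct Hx as [Hx|Hx]; apply (twisted_E H D W (phi a) D_subgroup) in Hx.
  - rewrite <- (mulKV _ (phi c) x). apply subgroupM; auto. now apply subgroupV.
  - replace x with ((phi c)^-1 * (phi c * x * phi a) * (phi a)^-1) by now gsimp.
    apply subgroupM; auto; [apply subgroupM; auto|]; now apply subgroupV.
Qed.

(** Otherwise [t * t] lies in [D], so [(t ^ N) ^ 2 = 1], and the absence of torsion among [N]-th
    powers contradicts [t_order]. *)
Let t_not_fixed : phi a * t <> t * phi a.
Proof.
  intros E. assert (Ht : D (t * t)) by now apply (twisted_commute_square H D W (phi a)).
  apply t_order, (power_torsion_H 2); [lia|].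
  rewrite <- zpow_mul, Z.mul_comm, zpow_mul, zpow_2. now apply D_exponent.
Qed.

Let W_no_reflection c x : D c -> W x -> ~ W (c * x * phi a).
Proof.
  intros Hc Hx [_ E]. fold t in E. apply t_not_fixed.
  apply (mul_cancel_l _ (c * x)). rewrite gmul_assoc, E, !gmul_assoc. f_equal.
  rewrite <- gmul_assoc. apply commute_mul.
  - now apply commute_sym, DW.
  - now apply W_comm.
Qed.

(* [x => x ^ N] is a homomorphism from [W] with kernel its torsion [W ∩ D], so [W] modulo
   torsion is realized as a subgroup of [H]. *)
Let powers (p : H) := exists x, W x /\ p = x ^ N.

Let powers_subgroup : subgroup powers.
Proof.
  split; [|split].
  - exists 1; split; [now apply subgroup1 | now rewrite zpow_one].
  - intros ? ? [x [Hx ->]] [y [Hy ->]]. exists (x * y); split; [now apply subgroupM|].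
    symmetry; now apply zpow_mul_commute, W_comm.
  - intros ? [x [Hx ->]]. exists (x^-1); split; [now apply subgroupV|].
    now rewrite zpowV.
Qed.

Let P := subgroup_grp H powers powers_subgroup.

Let P_ext (p q : P) : val H p = val H q -> p = q.
Proof. apply sig_ext. Qed.

Let val_X (p : P) n : val H (p ^ n) = val H p ^ n.
Proof. apply (homX P H (val H)). intros x y; reflexivity. Qed.

Let P_comm (p q : P) : p * q = q * p.
Proof.
  apply P_ext. rewrite !valM.
  destruct p as [? (x & Hx & ->)], q as [? (y & Hy & ->)]; cbn.
  apply W_comm; now apply subgroupX.
Qed.

Let P_torsion_free (p : P) k : (0 < k)%Z -> p ^ k = 1 -> p = 1.
Proof.
  intros Hk E. apply P_ext. apply (f_equal (val H)) in E. rewrite val_X in E.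
  destruct p as [? (x & Hx & ->)]; cbn in *. apply (power_torsion_H k); auto. lia.
Qed.

Let P_square (p q : P) : exists z, p = z * z \/ q = z * z \/ p * q = z * z.
Proof.
  (* The root [z] comes from [H], so [z ^ N] need not lie in [powers]. If [z = c * e], then [e ^ N]
     replaces it; if [z = c * e * phi a], then [z * z] is in [D], the square of [z ^ N] is trivial
     and [1] serves. *)
  assert (Hz : forall z : H, exists r : P, val H r * val H r = z ^ N * z ^ N).
  { intros z. destruct (H_normal_form z) as (c & e & Hc & He & [-> | ->]).
    - assert (Pe : powers (e ^ N)) by now exists e.
      exists (exist _ _ Pe : P). cbn.
      now rewrite zpow_mul_commute, (D_exponent c), gmul_1l by auto.
    - exists 1. cbn. rewrite <- (zpow_2 _ (_ ^ N)), <- zpow_mul, Z.mul_comm, zpow_mul, zpow_2.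
      rewrite D_exponent, gmul_1l; auto. now apply (twisted_square H D W). }
  destruct p as [? (x & Hx & ->)] eqn:Ep, q as [? (y & Hy & ->)] eqn:Eq.
  rewrite <- Ep, <- Eq.
  destruct (power_square_H x y) as [z E], (Hz z) as [r Hr].
  rewrite <- Hr in E. exists r.
  destruct E as [E|[E|E]]; [left|right; left|right; right]; apply P_ext;
    rewrite ?valM, ?Ep, ?Eq; exact E.
Qed.

(** The [N]-th powers of the [W]-parts of the generators of [H] generate [P]. *)
Let P_generated : exists l : list P, generates l.
Proof.
  destruct generated_H as [l Hl].
  assert (Hes : exists es, Forall W es /\ Forall (fun x : H => exists c e : H, D c /\ In e es /\
            (x = c * e \/ x = c * e * phi a)) l).
  { clear Hl. induction l as [|x l (es & Hes & IH)].
    - exists []; split; constructor.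
    - destruct (H_normal_form x) as (c & e & Hc & He & Hx).
      exists (e :: es); split; [now constructor|]. constructor.
      + exists c, e; repeat split; auto; now left.
      + revert IH; apply Forall_impl. intros y (c' & e' & Hc' & He' & Hy).
        exists c', e'; repeat split; auto; now right. }
  destruct Hes as (es & Hes & Hles).
  assert (Hps : exists ps : list P, forall e, In e es -> exists p, In p ps /\ val H p = e ^ N).
  { clear Hles. induction Hes as [|e es He Hes [ps IH]]; [now exists []|].
    assert (Pe : powers (e ^ N)) by now exists e.
    exists ((exist _ _ Pe : P) :: ps). intros x [<-|Hx].
    - exists (exist _ _ Pe : P); split; [now left | reflexivity].
    - destruct (IH x Hx) as (p & Hp & Ep). exists p; split; auto; now right. }
  destruct Hps as [ps Hps]. exists ps. intros S HS Sps p.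
  (* With [E] the part of [W] whose [N]-th powers lie in [S], the twisted elements over [E] form a
     subgroup containing the generators of [H], hence all of [H]. An element of [W] cannot be of the
     form [c * e * phi a], so its [N]-th power lies in [S]. *)
  set (E := fun e => W e /\ exists q, S q /\ val H q = e ^ N).
  assert (HE : subgroup E).
  { split; [|split].
    - split; [now apply subgroup1|]. exists 1; split; [now apply subgroup1|].
      symmetry; apply zpow_one.
    - intros x y [Hx (q & Sq & Eq)] [Hy (r & Sr & Er)]. split; [now apply subgroupM|].
      exists (q * r); split; [now apply subgroupM|].
      rewrite valM, Eq, Er. symmetry. now apply zpow_mul_commute, W_comm.
    - intros x [Hx (q & Sq & Eq)]. split; [now apply subgroupV|].
      exists (q^-1); split; [now apply subgroupV|]. rewrite valV, Eq.
      now rewrite zpowV. }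
  assert (DE : forall c e, D c -> E e -> commute c e) by (intros c e Hc []; auto).
  assert (inv : forall e, E e -> exists d, D d /\ phi a * e = d * e^-1 * phi a)
    by (intros e []; auto).
  assert (Hall : forall x, twisted H D E (phi a) x).
  { apply Hl; [now apply subgroup_twisted|]. intros x Hx.
    apply (proj1 (Forall_forall _ _) Hles) in Hx as (c & e & Hc & He & Hx).
    destruct (Hps e He) as (q & Hq & Eq). exists c, e; split; [|split; [split|]]; auto.
    - now apply (proj1 (Forall_forall _ _) Hes).
    - exists q; auto. }
  destruct p as [? (x & Hx & ->)] eqn:Ep. rewrite <- Ep.
  destruct (Hall x) as (c & e & Hc & [He (q & Sq & Eq)] & [-> | ->]).
  - replace p with q; auto. apply P_ext. rewrite Eq, Ep; cbn.
    now rewrite zpow_mul_commute, (D_exponent c), gmul_1l by auto.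
  - now destruct (W_no_reflection c e Hc He).
Qed.

(** If [s ^ N] generates the [N]-th powers of [W], then each [x] in [W] differs from some [s ^ n] by
    an element with trivial [N]-th power, and such an element of [W] is in [D]. *)
Let generator : exists s, W s /\ forall x, W x -> exists c n, D c /\ x = c * s ^ n.
Proof.
  destruct (fg_torsion_free_cyclic P P_comm P_torsion_free P_square P_generated) as [p Hp].
  destruct p as [? (s & Hs & ->)]. exists s; split; auto. intros x Hx.
  assert (Px : powers (x ^ N)) by now exists x.
  destruct (Hp (exist _ _ Px)) as [n E]. apply (f_equal (val H)) in E.
  rewrite val_X in E; cbn in E.
  assert (Hsn : W (s ^ n)) by now apply subgroupX.
  exists (x * (s ^ n)^-1), n; split; [|now gsimp].
  apply W_torsion; [apply subgroupM; auto; now apply subgroupV|].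
  rewrite zpow_mul_commute by (apply W_comm; auto; now apply subgroupV).
  rewrite E, <- zpowN, <- !zpow_mul, <- zpow_add.
  replace (N * n + - n * N)%Z with 0%Z by lia. reflexivity.
Qed.

(* The generator [s] can be chosen so that [phi a] and a conjugate of [phi b] multiply to [s]:
   [t] is an odd power [s ^ (2 * j + 1)] modulo [D], since it is not a square modulo [D],
   and conjugation by [s ^ j] multiplies [phi b] by [s ^ (- 2 * j)] modulo [D]. *)
Let adjusted_generator : exists r, W r /\
  W (phi a * (r * phi b * r^-1)) /\
  forall x, W x -> exists c n, D c /\ x = c * (phi a * (r * phi b * r^-1)) ^ n.
Proof.
  destruct generator as (s & Hs & gen).
  destruct (gen t W_t) as (c0 & k & Hc0 & Et).
  assert (Hk : exists j, k = (2 * j + 1)%Z).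
  { destruct (Z.Even_or_Odd k) as [[j Hj]|[j Hj]]; [exfalso|now exists j].
    destruct (Hax (s ^ j) 1) as (_ & _ & _ & _ & _ & _ & _ & _ & Hx).
    destruct (subgroupV _ _ _ D_subgroup Hc0) as (c & Hc & Ec).
    apply (Hx c Hc). fold t. rewrite <- Ec, Et, mulKV, <- zpow_2, <- zpow_mul, Hj.
    f_equal; lia. }
  destruct Hk as [j ->]. set (r := s ^ j).
  assert (Hr : W r) by now apply subgroupX.
  destruct (W_inverts r Hr) as (d & Hd & Ed).
  assert (E : phi a * (r * phi b * r^-1) = d * c0 * s).
  { rewrite <- gmul_assoc, gmul_assoc, Ed. transitivity (d * r^-1 * t * r^-1).
    - unfold t; now gsimp.
    - rewrite Et. unfold r. rewrite <- zpowN, <- !gmul_assoc. f_equal.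
      rewrite (gmul_assoc _ _ c0).
      rewrite <- (DW c0 (s ^ (- j))); auto; [|now apply subgroupX].
      rewrite <- gmul_assoc, <- !zpow_add. f_equal.
      replace (- j + (2 * j + 1 + - j))%Z with 1%Z by lia. apply zpow1. }
  assert (Hz : D (d * c0)) by now apply subgroupM.
  assert (Ws : W (phi a * (r * phi b * r^-1))).
  { split.
    - intros c Hc. symmetry.
      assert (Dc : D (phi c)) by now exists c.
      assert (Wr : commute (phi c) r) by auto.
      apply commute_mul; [now apply D_a|].
      repeat apply commute_mul; auto. now apply commute_inv.
    - rewrite E. symmetry. apply commute_mul; [|now apply commute_sym, W_comm].
      apply commute_sym. now apply DW. }
  exists r; split; [|split]; auto. intros x Hx.
  destruct (gen x Hx) as (c & n & Hc & ->).
  exists (c * ((d * c0) ^ n)^-1), n; split.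
  - apply subgroupM; auto. apply subgroupV; auto. now apply subgroupX.
  - rewrite E, (zpow_mul_commute _ (d * c0) s) by auto. now rewrite <- gmul_assoc, mulKV.
Qed.

(** A nonzero [n] would give [(s ^ N) ^ n = 1], hence [s ^ N = 1]; but [t] is a power of [s] modulo
    [D], so [t ^ N = 1] would follow. *)
Let generator_order s : (forall x, W x -> exists c n, D c /\ x = c * s ^ n) -> W s ->
  forall n, D (s ^ n) -> n = 0%Z.
Proof.
  intros gen Hs n Hn. apply NNPP; intros n0. apply t_order.
  assert (E : s ^ N = 1).
  { apply (power_torsion_H n); auto.
    rewrite <- zpow_mul, Z.mul_comm, zpow_mul. now apply D_exponent. }
  destruct (gen t W_t) as (c & k & Hc & ->).
  assert (Wk : W (s ^ k)) by now apply subgroupX.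
  rewrite zpow_mul_commute, (D_exponent c), gmul_1l by auto.
  now rewrite <- zpow_mul, Z.mul_comm, zpow_mul, E, zpow_one.
Qed.

Hypothesis HG : amalgam_decomp G A B C.
Hypothesis G_normal_form : forall x, twisted G C (fun x => exists n, x = (a * b) ^ n) a x.

Lemma model_isomorphic : isomorphic H G.
Proof.
  destruct adjusted_generator as (r & Hr & Hs & gen).
  set (s := phi a * (r * phi b * r^-1)) in *.
  destruct HG as (_ & _ & HCAB & Huniv).
  (* Only the map on [B] is conjugated by [r]; the two maps still agree on [C] because [r] in [W]
     centralizes [D]. *)
  destruct (Huniv H phi (fun x => r * phi x * r^-1)) as [(h & Hh & hA & hB) _].
  - intros x y Hx Hy; now apply phiA.
  - intros x y Hx Hy. rewrite phiB by auto. now gsimp.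
  - intros c Hc. assert (E : commute (phi c) r) by (apply DW; auto; now exists c).
    rewrite <- E. now gsimp.
  - assert (ht : forall n, h ((a * b) ^ n) = s ^ n).
    { intros n. rewrite homX by auto. unfold s. now rewrite Hh, hA, hB. }
    apply (bijective_hom_isomorphic G H h); auto.
    (* The kernel is read off the normal form of [G]: [phi c * s ^ n = 1] forces [n = 0] and then
       [c = 1], while [phi c * s ^ n * phi a] is never in [W]. *)
    + intros x Ex. destruct (G_normal_form x) as (c & e & Hc & [n ->] & [-> | ->]).
      * rewrite Hh, ht, hA in Ex by auto.
        assert (n = 0%Z).
        { apply (generator_order s); auto.
          replace (s ^ n) with ((phi c)^-1).
          - apply subgroupV; auto. now exists c.
          - symmetry. now apply inv_unique. }
        subst n. rewrite zpow0 in *. rewrite gmul_1r in *. auto.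
      * exfalso. rewrite !Hh, ht, !hA in Ex by auto.
        apply (W_no_reflection (phi c) (s ^ n)); [now exists c | now apply subgroupX|].
        rewrite Ex. now apply subgroup1.
    (* The image contains [D], [s] and [phi a], which by the normal form of [H] give every
       element. *)
    + assert (HS := subgroup_image G H h Hh).
      assert (hD : forall c, D c -> exists x, c = h x).
      { intros c [d [Hd ->]]. exists d; symmetry; auto. }
      intros y. destruct (H_normal_form y) as (c & e & Hc & He & Hy).
      destruct (gen e He) as (d & n & Hd & ->).
      destruct (hD c Hc) as [u ->], (hD d Hd) as [v ->].
      destruct Hy as [-> | ->].
      * exists (u * (v * (a * b) ^ n)). now rewrite !Hh, ht.
      * exists (u * (v * (a * b) ^ n) * a). now rewrite !Hh, ht, (hA a).
Qed.

End Model.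

(** * The rigidity theorem *)

Theorem theorem8p9 (G : Grp) (A B C : G -> Prop) :
  infinite_group G ->
  torsion_generated G ->
  virtually_cyclic G ->
  amalgam_decomp G A B C ->
  finite_set A -> finite_set B ->
  has_index A C 2 -> has_index B C 2 ->
  normalizer_image_inner C ->
  first_order_rigid G /\
  (forall H : Grp, finitely_generated H -> AE_equiv H G -> isomorphic H G).
Proof.
  intros Hinf _ _ HG finA finB HAC HBC Hinn.
  enough (rigid : forall H : Grp, finitely_generated H -> AE_equiv H G -> isomorphic H G).
  (* Elementary equivalence implies AE-equivalence, so first-order rigidity is a special case. *)
  { split; auto. intros H Hfg HE. apply rigid; auto. intros phi [Hphi _]; auto. }
  destruct (index2_centralizing G A C HAC Hinn) as (a & Aa & Ca & Caa & Acos).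
  destruct (index2_centralizing G B C HBC Hinn) as (b & Bb & Cb & Cbb & Bcos).
  destruct HAC as (HA & HC & CA & _), HBC as (HB & _ & CB & _).
  assert (finC : finite_set C).
  { destruct finA as [l Hl].
    exists (filter (fun x => if excluded_middle_informative (C x) then true else false) l).
    intros x. rewrite filter_In, <- Hl. destruct excluded_middle_informative as [Cx|nCx];
      [now split; auto | now split; [|intros [_ ?]]]. }
  assert (gen : forall S : G -> Prop, subgroup S ->
            (forall c, C c -> S c) -> S a -> S b -> forall x, S x).
  { intros S HS SC Sa Sb. apply (amalgam_generated G A B C S HG HS).
    - intros x Ax. destruct (Acos x Ax) as [|(c & Hc & ->)]; auto. apply subgroupM; auto.
    - intros x Bx. destruct (Bcos x Bx) as [|(c & Hc & ->)]; auto. apply subgroupM; auto. }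
  pose proof (reflections_normal_form G C a b HC Ca Cb Caa Cbb gen) as nf.
  pose proof (translation_infinite_order G C a b HC Ca Cb Caa Cbb gen Hinf finC) as ord.
  destruct (exponent_finite G C HC finC) as (m & Hm & Em).
  intros H Hfg HE.
  destruct (named_theory_transfer G A B C a b (2 * m) HA HB finA finB finC CA Aa Bb H HE)
    as [phi Hphi].
  { now apply reflections_named_theory. }
  apply (model_isomorphic G A B C a b (2 * m)) with (phi := phi); auto.
  - intros c Hc. rewrite Z.mul_comm, zpow_mul, Em by auto. apply zpow_one.
  - intros k x Hk. apply (power_torsion_transfer G H (2 * m) k HE).
    intros y. now apply (power_torsion G C a b m).
  - apply (power_square_transfer G H (2 * m) HE). now apply (power_square G C a b m).
  - now apply finitely_generated_generates.
Qed.
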